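(* Let $G$ be a finite group and let $k$ be an algebraically closed field of characteristic $p>0$. There is a map of sets $\Theta: H^2_\ell(\mathcal{O}_k(G))\to\mathcal{B}(G)$ such that: (a) the subset $\Theta^{-1}(1)$ is a subgroup of $H^2_\ell(\mathcal{O}_k(G))$ isomorphic to $\mathrm{Int}_k(G)/\mathrm{Inn}(G)$; (b) the (non-empty) fibres of $\Theta$ are the left cosets of $\Theta^{-1}(1)$; (c) $\Theta$ is surjective if all the subgroups $A$ involved in the definition of $\mathcal{B}(G)$ (i.e. all $A$ such that $(A,b)\in\mathcal{B}(G)$ for some $b$) have odd order. In particular, $\Theta$ is surjective if $k$ has characteristic $2$.
   Context: $\mathcal{O}_k(G)$ is the Hopf algebra of $k$-valued functions on $G$; its dual is the group algebra $k[G]$ with coproduct $\Delta(g)=g\otimes g$. The second lazy cohomology group $H^2_\ell(\mathcal{O}_k(G))$ is described as follows. Let $Z^2$ be the group of all invertible elements $F\in k[G]\otimes k[G]$ such that $\Delta(a)F=F\Delta(a)$ for all $a\in k[G]$ (invariance) and $(F\otimes 1)(\Delta\otimes \mathrm{id})(F)=(1\otimes F)(\mathrm{id}\otimes\Delta)(F)$ (Drinfeld twist condition). Let $B^2\subset Z^2$ be the subgroup of elements of the form $(a\otimes a)\Delta(a^{-1})$ with $a$ an invertible central element of $k[G]$. Then $H^2_\ell(\mathcal{O}_k(G))=Z^2/B^2$ (a possibly non-commutative group). $\mathcal{B}(G)$ is the set of pairs $(A,b)$ where $A$ is an abelian, normal subgroup of $G$ of order prime to $p$, and $b:\widehat{A}\times\widehat{A}\to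 k^\times$ is an alternating bilinear form (that is, $b(x,x)=1$ for all $x$) which is non-degenerate and $G$-invariant for the action of $G$ induced by conjugation on $A$; here $\widehat{A}=\mathrm{Hom}(A,k^\times)$. The element $1\in\mathcal{B}(G)$ is the pair consisting of the trivial subgroup and the trivial form. $\mathrm{Int}_k(G)$ is the group of automorphisms of $G$ induced by conjugation by (invertible) elements of $k[G]$ (those normalizing $G$), and $\mathrm{Inn}(G)$ is the group of inner automorphisms of $G$. *)

(* Defs.v *)
From HB Require Import structures.
From mathcomp Require Import all_boot all_order all_fingroup all_algebra all_field.
From mathcomp Require Import boolp classical_sets functions.

Set Implicit Arguments.
Unset Strict Implicit.
Unset Printing Implicit Defensive.

Import GRing.Theory.
Local Open Scope quotient_scope.
Local Open Scope ring_scope.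

(* [finalg] provides [{unit R}] for finite [R] only. *)
Section Units.
Variable R : unitRingType.

Record units := Units { units_val :> R; units_prf : units_val \is a GRing.unit }.

HB.instance Definition _ := [isSub for units_val].
HB.instance Definition _ := [Choice of units by <:].

Implicit Types u v w : units.

Definition units_one : units := Units (unitr1 R).
Definition units_mul u v : units :=
  Units (etrans (unitrMr _ (units_prf u)) (units_prf v)).
Definition units_inv u : units := Units (etrans (unitrV _) (units_prf u)).

Lemma units_mulA : associative units_mul.
Proof. by move=> u v w; apply/val_inj/mulrA. Qed.
Lemma units_mul1 : left_id units_one units_mul.
Proof. by move=> u; apply/val_inj/mul1r. Qed.
Lemma units_1mul : right_id units_one units_mul.
Proof. by move=> u; apply/val_inj/mulr1. Qed.
Lemma units_mulV : left_inverse units_one units_inv units_mul.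
Proof. by move=> u; apply/val_inj/mulVr/units_prf. Qed.
Lemma units_Vmul : right_inverse units_one units_inv units_mul.
Proof. by move=> u; apply/val_inj/mulrV/units_prf. Qed.

HB.instance Definition _ :=
  isGroup.Build units units_mulA units_mul1 units_1mul units_mulV units_Vmul.

Lemma units_valM u v : (u * v)%g = (u : R) * (v : R) :> R. Proof. by []. Qed.
Lemma units_val1 : (1 : units)%g = 1 :> R. Proof. by []. Qed.
Lemma units_valV u : (u^-1)%g = (u : R)^-1 :> R. Proof. by []. Qed.

End Units.

(* A copy of [{ffun G -> k}], whose canonical product is the pointwise one. *)
Definition grpAlg (k : fieldType) (G : finGroupType) : Type := {ffun G -> k^o}.

Section GroupAlgebra.
Variables (k : fieldType) (G : finGroupType).
Implicit Types a b c : grpAlg k G.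

HB.instance Definition _ := Vector.copy (grpAlg k G) {ffun G -> k^o}.

Definition ga_delta (g : G) : grpAlg k G := [ffun x => (x == g)%:R].
Definition ga_mul a b : grpAlg k G :=
  [ffun x => \sum_y (a y * b (y^-1 * x)%g : k)].

Lemma ga_mulA : associative ga_mul.
Proof.
move=> a b c; apply/ffunP=> x; rewrite !ffunE.
under eq_bigr => y _ do rewrite ffunE mulr_sumr.
under [RHS]eq_bigr => z _ do rewrite ffunE mulr_suml.
rewrite [RHS]exchange_big; apply: eq_bigr => y _ /=.
rewrite [RHS](reindex_inj (mulgI y)); apply: eq_bigr => z _ /=.
by rewrite mulKg invMg mulgA mulrA.
Qed.

Lemma ga_mul1 : left_id (ga_delta 1%g) ga_mul.
Proof.
move=> a; apply/ffunP=> x; rewrite !ffunE (bigD1 1%g) //= ffunE eqxx mul1r.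
rewrite invg1 mul1g big1 ?addr0 // => y /negPf ny.
by rewrite ffunE ny mul0r.
Qed.

Lemma ga_1mul : right_id (ga_delta 1%g) ga_mul.
Proof.
move=> a; apply/ffunP=> x; rewrite !ffunE (bigD1 x) //= ffunE mulVg eqxx mulr1.
rewrite big1 ?addr0 // => y /negPf ny.
by rewrite ffunE -eq_mulVg1 ny mulr0.
Qed.

Lemma ga_mulDl : left_distributive ga_mul +%R.
Proof.
move=> a b c; apply/ffunP=> x; rewrite !ffunE -big_split.
by apply: eq_bigr => y _; rewrite ffunE mulrDl.
Qed.

Lemma ga_mulDr : right_distributive ga_mul +%R.
Proof.
move=> a b c; apply/ffunP=> x; rewrite !ffunE -big_split.
by apply: eq_bigr => y _; rewrite ffunE mulrDr.
Qed.

Lemma ga_1neq0 : ga_delta 1%g != 0.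
Proof.
by apply/eqP => /ffunP/(_ 1%g)/eqP; rewrite !ffunE eqxx oner_eq0.
Qed.

HB.instance Definition _ := GRing.Zmodule_isNzRing.Build (grpAlg k G)
  ga_mulA ga_mul1 ga_1mul ga_mulDl ga_mulDr ga_1neq0.

Lemma ga_mulE a b x : (a * b) x = \sum_y (a y * b (y^-1 * x)%g).
Proof. by rewrite ffunE. Qed.

Lemma ga_scaleAl (s : k) a b : s *: (a * b) = (s *: a) * b.
Proof.
apply/ffunP=> x; rewrite !ffunE /GRing.scale /= mulr_sumr.
by apply: eq_bigr => y _; rewrite ffunE mulrA.
Qed.
Lemma ga_scaleAr (s : k) a b : s *: (a * b) = a * (s *: b).
Proof.
apply/ffunP=> x; rewrite !ffunE /GRing.scale /= mulr_sumr.
by apply: eq_bigr => y _; rewrite ffunE mulrCA.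
Qed.

HB.instance Definition _ :=
  GRing.Lmodule_isLalgebra.Build k (grpAlg k G) ga_scaleAl.
HB.instance Definition _ :=
  GRing.Lalgebra_isAlgebra.Build k (grpAlg k G) ga_scaleAr.
HB.instance Definition _ := Algebra_isFalgebra.Build k (grpAlg k G).

Lemma ga_deltaM g h : ga_delta (g * h)%g = ga_delta g * ga_delta h.
Proof.
apply/ffunP=> x; rewrite ga_mulE (bigD1 g) //= !ffunE eqxx mul1r.
rewrite big1 ?addr0 => [|y /negPf ny]; last by rewrite !ffunE ny mul0r.
by rewrite (can2_eq (mulKVg g) (mulKg g)).
Qed.

End GroupAlgebra.

Section Functoriality.
Variable k : fieldType.
Implicit Types G H : finGroupType.

(* The linear extension k[G] -> k[H] of a map G -> H. *)
Definition ga_map G H (f : G -> H) (a : grpAlg k G) : grpAlg k H :=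
  [ffun h => \sum_(g | f g == h) a g].

(* Throughout, k[G] (x) k[H] is identified with k[G x H] by
   delta_g (x) delta_h = delta_(g, h). *)
Definition ga_tens G H (a : grpAlg k G) (b : grpAlg k H) : grpAlg k (G * H)%type :=
  [ffun x => a x.1 * b x.2].

Lemma ga_map_delta G H (f : G -> H) g :
  ga_map f (ga_delta k g) = ga_delta k (f g).
Proof.
apply/ffunP=> h; rewrite !ffunE big_mkcond (bigD1 g) //= ffunE eqxx.
rewrite big1 ?addr0 => [|x /negPf nx]; last by rewrite ffunE nx; case: ifP.
by rewrite [h == _]eq_sym; case: eqP.
Qed.

Lemma ga_tens_delta G H (g : G) (h : H) :
  ga_tens (ga_delta k g) (ga_delta k h) = ga_delta k (g, h).
Proof. by apply/ffunP=> -[x y]; rewrite !ffunE /= -natrM mulnb. Qed.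

Lemma ga_map_linear G H (f : G -> H) : linear (@ga_map G H f).
Proof.
move=> s a b; apply/ffunP=> h; rewrite !ffunE /GRing.scale /= mulr_sumr.
by rewrite -big_split; apply: eq_bigr => g _; rewrite !ffunE.
Qed.

HB.instance Definition _ G H (f : G -> H) :=
  GRing.isLinear.Build k (grpAlg k G) (grpAlg k H) _ _ (@ga_map_linear G H f).

Lemma ga_sum_delta G (a : grpAlg k G) : a = \sum_g a g *: ga_delta k g.
Proof.
apply/ffunP=> x; rewrite sum_ffunE (bigD1 x) //= !ffunE eqxx /GRing.scale /= mulr1.
rewrite big1 ?addr0 // => y /negPf ny.
by rewrite !ffunE eq_sym ny /GRing.scale /= mulr0.
Qed.

Lemma ga_map1 G H (f : G -> H) : f 1%g = 1%g -> ga_map f 1 = 1.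
Proof. by move=> f1; rewrite [LHS]ga_map_delta f1. Qed.

Lemma ga_mapM G H (f : G -> H) : {morph f : x y / (x * y)%g} ->
  {morph ga_map f : a b / a * b}.
Proof.
move=> fM a b; apply/ffunP=> h; rewrite ga_mulE !ffunE.
have fV x y : (f (x^-1 * y) = (f x)^-1 * f y)%g.
  by apply: (mulgI (f x)); rewrite -fM !mulKVg.
under eq_bigr => x _ do rewrite ga_mulE.
rewrite exchange_big /= (partition_big f predT) //=; apply: eq_bigr => z _.
rewrite !ffunE mulr_suml; apply: eq_bigr => x /eqP fxz.
rewrite mulr_sumr (reindex_inj (mulgI x)); apply: eq_big => [y|y _].
  by rewrite fM fxz (can2_eq (mulKg z) (mulKVg z)).
by rewrite mulKg.
Qed.

Lemma ga_tens1 G H : ga_tens 1 1 = 1 :> grpAlg k (G * H)%type.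
Proof. exact: ga_tens_delta. Qed.

Lemma ga_tensM G H (a a' : grpAlg k G) (b b' : grpAlg k H) :
  ga_tens (a * a') (b * b') = ga_tens a b * ga_tens a' b'.
Proof.
apply/ffunP=> -[x y]; rewrite ga_mulE ffunE /= !ga_mulE big_distrlr /=.
rewrite pair_big; apply: eq_bigr => -[u v] _ /=; rewrite !ffunE /=.
by rewrite mulrACA.
Qed.

End Functoriality.

Section Twists.
Variables (k : fieldType) (G : finGroupType).
Implicit Types (a : grpAlg k G) (F : grpAlg k (G * G)%type).

Definition comul : grpAlg k G -> grpAlg k (G * G)%type :=
  ga_map (fun g => (g, g)).
(* Delta (x) id, with k[G] (x) k[G] (x) k[G] bracketed to the left *)
Definition comul_id : grpAlg k (G * G)%type -> grpAlg k (G * G * G)%type :=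
  ga_map (fun x => (x.1, x.1, x.2)).
Definition id_comul : grpAlg k (G * G)%type -> grpAlg k (G * (G * G))%type :=
  ga_map (fun x => (x.1, (x.2, x.2))).
Definition ga_assoc : grpAlg k (G * (G * G))%type -> grpAlg k (G * G * G)%type :=
  ga_map (fun x => (x.1, x.2.1, x.2.2)).

Definition comul_invariant F := forall a, comul a * F = F * comul a.
Definition twist_condition F :=
  ga_tens F (1 : grpAlg k G) * comul_id F
  = ga_assoc (ga_tens (1 : grpAlg k G) F * id_comul F).

HB.instance Definition _ := GRing.Linear.on comul.
HB.instance Definition _ := GRing.Linear.on comul_id.
HB.instance Definition _ := GRing.Linear.on id_comul.
HB.instance Definition _ := GRing.Linear.on ga_assoc.

Lemma comulM : {morph comul : a b / a * b}.
Proof. exact: ga_mapM. Qed.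
Lemma comul_idM : {morph comul_id : F F' / F * F'}.
Proof. exact: ga_mapM. Qed.
Lemma id_comulM : {morph id_comul : F F' / F * F'}.
Proof. exact: ga_mapM. Qed.
Lemma ga_assocM : {morph ga_assoc : F F' / F * F'}.
Proof. exact: ga_mapM. Qed.

Lemma comul_id_comm F F' : comul_invariant F' ->
  comul_id F * ga_tens F' (1 : grpAlg k G)
  = ga_tens F' (1 : grpAlg k G) * comul_id F.
Proof.
move=> iF; rewrite [F]ga_sum_delta linear_sum mulr_suml mulr_sumr.
apply: eq_bigr => -[g h] _; rewrite linearZ /= -scalerAl -scalerAr; congr (_ *: _).
rewrite [comul_id _]ga_map_delta -ga_tens_delta -!ga_tensM mulr1 mul1r.
by rewrite -(ga_map_delta k (fun g => (g, g)) g) -iF.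
Qed.

Lemma id_comul_comm F F' : comul_invariant F' ->
  id_comul F * ga_tens (1 : grpAlg k G) F'
  = ga_tens (1 : grpAlg k G) F' * id_comul F.
Proof.
move=> iF; rewrite [F]ga_sum_delta linear_sum mulr_suml mulr_sumr.
apply: eq_bigr => -[g h] _; rewrite linearZ /= -scalerAl -scalerAr; congr (_ *: _).
rewrite [id_comul _]ga_map_delta -ga_tens_delta -!ga_tensM mulr1 mul1r.
by rewrite -(ga_map_delta k (fun g => (g, g)) h) -iF.
Qed.

Lemma invariantM F F' : comul_invariant F -> comul_invariant F' -> comul_invariant (F * F').
Proof. by move=> iF iF' a; rewrite mulrA iF -mulrA iF' mulrA. Qed.

Lemma invariantV F : F \is a GRing.unit -> comul_invariant F -> comul_invariant F^-1.
Proof.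
move=> uF iF a; apply: (mulrI uF); rewrite mulrA -iF mulrK //.
by rewrite mulrA divrr // mul1r.
Qed.

Lemma twist_conditionM F F' : comul_invariant F -> comul_invariant F' ->
  twist_condition F -> twist_condition F' -> twist_condition (F * F').
Proof.
rewrite /twist_condition => iF iF' tF tF'.
have -> : ga_tens (F * F') (1 : grpAlg k G) = ga_tens F 1 * ga_tens F' 1.
  by rewrite -ga_tensM mulr1.
have -> : ga_tens (1 : grpAlg k G) (F * F') = ga_tens 1 F * ga_tens 1 F'.
  by rewrite -ga_tensM mulr1.
rewrite comul_idM id_comulM.
rewrite mulrA -(mulrA _ (ga_tens F' 1)) -comul_id_comm // mulrA tF
  -[LHS]mulrA tF'.
rewrite -ga_assocM; congr ga_assoc.
rewrite !mulrA; congr (_ * _); rewrite -!mulrA; congr (_ * _).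
exact: id_comul_comm.
Qed.

Lemma twist_conditionV F : F \is a GRing.unit -> comul_invariant F ->
  twist_condition F -> twist_condition F^-1.
Proof.
rewrite /twist_condition => uF iF tF.
have tFV : ga_tens F (1 : grpAlg k G) * ga_tens F^-1 1 = 1.
  by rewrite -ga_tensM mulr1 divrr ?ga_tens1.
have tVF : ga_tens F^-1 (1 : grpAlg k G) * ga_tens F 1 = 1.
  by rewrite -ga_tensM mulr1 mulVr ?ga_tens1.
have dVF : comul_id F^-1 * comul_id F = 1.
  by rewrite -comul_idM mulVr ?[LHS]ga_map1.
have sFV : ga_tens (1 : grpAlg k G) F * ga_tens 1 F^-1 = 1.
  by rewrite -ga_tensM mulr1 divrr ?ga_tens1.
have eFV : id_comul F * id_comul F^-1 = 1.
  by rewrite -id_comulM divrr ?[LHS]ga_map1.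
have iFV := invariantV uF iF.
have /(congr1 (fun x => ga_tens F^-1 1 * comul_id F^-1 * x)) :
    ga_assoc (ga_tens 1 F * id_comul F) * ga_assoc (ga_tens 1 F^-1 * id_comul F^-1)
    = 1 :> grpAlg k (G * G * G)%type.
  rewrite -ga_assocM -mulrA (mulrA (id_comul F)) (id_comul_comm _ iFV).
  by rewrite -mulrA eFV mulr1 sFV [LHS]ga_map1.
rewrite mulr1 -tF => <-.
rewrite !mulrA -(mulrA _ _ (ga_tens F 1)) (comul_id_comm _ iF) !mulrA tVF mul1r.
by rewrite dVF mul1r.
Qed.

Definition Z2_pred : pred (units (grpAlg k (G * G)%type)) :=
  fun u => `[< comul_invariant (units_val u) /\ twist_condition (units_val u) >].

Lemma Z2_closed : group_closed Z2_pred.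
Proof.
have Z2_1 : (1%g : units (grpAlg k (G * G)%type)) \in Z2_pred.
  apply/asboolP; split=> [a|]; first by rewrite mulr1 mul1r.
  by rewrite /twist_condition !ga_tens1 !mul1r /comul_id /id_comul /ga_assoc !ga_map1.
split=> // u v /asboolP[iu tu] /asboolP[iv tv]; apply/asboolP.
have uv := units_prf v; split; first by apply: invariantM => //; apply: invariantV.
apply: twist_conditionM => //; first exact: invariantV.
exact: twist_conditionV.
Qed.

Definition Z2 := {u : units (grpAlg k (G * G)%type) | Z2_pred u}.
HB.instance Definition _ := [isSub for (@sval _ _ : Z2 -> _)].
HB.instance Definition _ := [Choice of Z2 by <:].
HB.instance Definition _ := SubChoice_isSubGroup.Build _ _ Z2 Z2_closed.

Definition ga_central a := forall x, a * x = x * a.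

Definition B2_pred : {pred Z2} :=
  fun u => `[< exists a : grpAlg k G, [/\ a \is a GRing.unit, ga_central a &
                 units_val (sval u) = ga_tens a a * comul a^-1] >].

Lemma central_tens a : ga_central a ->
  forall F, ga_tens a a * F = F * ga_tens a a.
Proof.
move=> ca F; rewrite [F]ga_sum_delta mulr_suml mulr_sumr.
apply: eq_bigr => -[g h] _; rewrite -scalerAl -scalerAr; congr (_ *: _).
by rewrite -ga_tens_delta -!ga_tensM !ca.
Qed.

Lemma B2_central (u v : Z2) : u \in B2_pred -> (u * v = v * u)%g.
Proof.
case/asboolP=> a [ua ca eu]; have /asboolP[iv _] := valP v.
apply/val_inj/val_inj; rewrite /= eu -mulrA iv !mulrA.
by rewrite (central_tens ca).
Qed.

Lemma B2_closed : group_closed B2_pred.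
Proof.
split=> [|u v].
  apply/asboolP; exists 1; split; first exact: unitr1.
    by move=> x; rewrite mulr1 mul1r.
  by rewrite invr1 ga_tens1 mul1r [RHS]ga_map1.
case/asboolP=> a [ua ca eu] /asboolP[b [ub cb ev]]; apply/asboolP.
have cV : ga_central b^-1.
  by move=> x; apply: (mulrI ub); rewrite mulrA divrr // mul1r mulrA cb mulrK.
have ca' : b^-1 * a^-1 = a^-1 * b^-1 by rewrite cV.
exists (a / b); split; first by rewrite unitrMr ?unitrV.
  by move=> x; rewrite -mulrA cV !mulrA ca.
rewrite /= eu; apply: (mulIr (units_prf (val v))).
rewrite -mulrA mulVr ?units_prf // mulr1 [val (val v)]ev.
rewrite [RHS]mulrA -(mulrA (ga_tens (a / b) _)) -(central_tens cb) mulrA.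
rewrite -ga_tensM -[RHS]mulrA -comulM divrK // invrM ?unitrV // invrK -mulrA.
by rewrite -ca' mulVKr.
Qed.

HB.instance Definition _ := isInvClosed.Build Z2 B2_pred (group_closedV B2_closed).
HB.instance Definition _ := isMul1Closed.Build Z2 B2_pred (fst B2_closed).
HB.instance Definition _ := isMulClosed.Build Z2 B2_pred (group_closedM B2_closed).

Definition H2_rel : rel Z2 := fun u v => (u^-1 * v)%g \in B2_pred.

Lemma H2_rel_equiv : equiv_class_of H2_rel.
Proof.
split=> [u|u v|v u w].
- by rewrite /H2_rel mulVg; apply: (fst B2_closed).
- by rewrite /H2_rel -(gpredV B2_pred) invgM invgK.
- move=> e1 e2; rewrite /H2_rel -(mulgKV v w).
  by have := gpredM _ _ e1 e2; rewrite mulgA mulgK mulgKV.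
Qed.
Canonical H2_equiv_rel := EquivRelPack H2_rel_equiv.

Definition H2 := {eq_quot H2_rel}.
HB.instance Definition _ := Choice.on H2.

Definition H2_class : Z2 -> H2 := \pi_H2.
Definition H2_repr : H2 -> Z2 := generic_quotient.repr.

Lemma H2_reprK : cancel H2_repr H2_class.
Proof. exact: reprK. Qed.

Lemma H2_classP u v : reflect (H2_class u = H2_class v) ((u^-1 * v)%g \in B2_pred).
Proof. exact: (eqmodP H2_equiv_rel). Qed.

Definition H2_one : H2 := H2_class 1%g.
Definition H2_mul (x y : H2) : H2 := H2_class (H2_repr x * H2_repr y)%g.
Definition H2_inv (x : H2) : H2 := H2_class (H2_repr x)^-1%g.

Lemma H2_mul_class u v : H2_mul (H2_class u) (H2_class v) = H2_class (u * v)%g.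
Proof.
have /H2_classP eu := H2_reprK (H2_class u).
have /H2_classP ev := H2_reprK (H2_class v).
apply/H2_classP; set u' := H2_repr _ in eu *; set v' := H2_repr _ in ev *.
have -> : ((u' * v')^-1 * (u * v) = (u'^-1 * u) * (v'^-1 * v))%g.
  by rewrite invgM -mulgA [X in (_ * X)%g]mulgA mulgA -(B2_central _ eu) !mulgA.
exact: gpredM.
Qed.

Lemma H2_mulA : associative H2_mul.
Proof.
move=> x y z; rewrite -(H2_reprK x) -(H2_reprK y) -(H2_reprK z).
by rewrite !H2_mul_class mulgA.
Qed.
Lemma H2_mul1 : left_id H2_one H2_mul.
Proof. by move=> x; rewrite -(H2_reprK x) H2_mul_class mul1g. Qed.
Lemma H2_1mul : right_id H2_one H2_mul.
Proof. by move=> x; rewrite -(H2_reprK x) H2_mul_class mulg1. Qed.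
Lemma H2_mulV : left_inverse H2_one H2_inv H2_mul.
Proof. by move=> x; rewrite -{2}(H2_reprK x) H2_mul_class mulVg. Qed.
Lemma H2_Vmul : right_inverse H2_one H2_inv H2_mul.
Proof. by move=> x; rewrite -{1}(H2_reprK x) H2_mul_class mulgV. Qed.

HB.instance Definition _ :=
  isGroup.Build H2 H2_mulA H2_mul1 H2_1mul H2_mulV H2_Vmul.

Lemma H2_classM u v : H2_class (u * v)%g = (H2_class u * H2_class v)%g.
Proof. by rewrite -H2_mul_class. Qed.

End Twists.

Section CharacterGroup.
Variables (k : fieldType) (G : finGroupType) (A : {group G}).

Definition charGrp_pred : pred {ffun [subg A] -> units k} :=
  fun chi => [forall x, forall y, chi (x * y)%g == (chi x * chi y)%g].

Lemma charGrp_predP (chi : {ffun [subg A] -> units k}) :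
  reflect {morph chi : x y / (x * y)%g} (charGrp_pred chi).
Proof.
apply: (iffP forallP) => [h x y|h x]; last by apply/forallP=> y; rewrite h.
by apply/eqP/(forallP (h x)).
Qed.

Lemma units_mulC : @commutative (units k) _ *%g.
Proof. by move=> u v; apply/val_inj/mulrC. Qed.

Lemma charGrp_closed : group_closed charGrp_pred.
Proof.
split=> [|chi psi /charGrp_predP hc /charGrp_predP hp].
  by apply/charGrp_predP=> x y; rewrite !ffunE mulg1.
apply/charGrp_predP=> x y; rewrite !ffunE hc hp invgM (units_mulC _^-1)%g.
exact/val_inj/mulrACA.
Qed.

(* Hom(A, k^x) *)
Definition charGrp := {chi : {ffun [subg A] -> units k} | charGrp_pred chi}.
HB.instance Definition _ := [isSub for (@sval _ _ : charGrp -> _)].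
HB.instance Definition _ := [Choice of charGrp by <:].
HB.instance Definition _ := SubChoice_isSubGroup.Build _ _ charGrp charGrp_closed.

Variable nA : (A <| [set: G])%g.

Definition charGrp_conj_fun (g : G) (chi : charGrp) : {ffun [subg A] -> units k} :=
  [ffun x => val chi (subg A (val x ^ g)%g)].

Lemma charGrp_conj_subproof g chi : charGrp_pred (charGrp_conj_fun g chi).
Proof.
have nAg (x : [subg A]) : (val x ^ g)%g \in A.
  by rewrite memJ_norm ?subgP // (fintype.subsetP (normal_norm nA)) ?inE.
apply/charGrp_predP=> x y; rewrite !ffunE; have /charGrp_predP <- := valP chi.
apply: congr1; apply/val_inj; rewrite [LHS](subgK _ (nAg (x * y)%g)) [LHS]conjMg.
by rewrite /= (subgK _ (nAg x)) (subgK _ (nAg y)).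
Qed.

(* (g . chi)(x) = chi(g^-1 x g) *)
Definition charGrp_conj (g : G) (chi : charGrp) : charGrp :=
  Sub (charGrp_conj_fun g chi) (charGrp_conj_subproof g chi).

End CharacterGroup.

Section Bset.
Variables (p : nat) (k : fieldType) (G : finGroupType).

Definition bimultiplicative (A : {group G}) (b : charGrp k A -> charGrp k A -> units k) :=
  (forall x y z, b (x * y)%g z = (b x z * b y z)%g) /\
  (forall x y z, b x (y * z)%g = (b x y * b x z)%g).

Definition form_alternating (A : {group G}) (b : charGrp k A -> charGrp k A -> units k) :=
  forall x, b x x = 1%g.

Definition form_nondegenerate (A : {group G}) (b : charGrp k A -> charGrp k A -> units k) :=
  (forall x, (forall y, b x y = 1%g) -> x = 1%g) /\
  (forall y, (forall x, b x y = 1%g) -> y = 1%g).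

Definition conj_invariant (A : {group G}) (nA : (A <| [set: G])%g)
    (b : charGrp k A -> charGrp k A -> units k) :=
  forall g x y, b (charGrp_conj nA g x) (charGrp_conj nA g y) = b x y.

Record BG := {
  BG_grp : {group G};
  BG_form : charGrp k BG_grp -> charGrp k BG_grp -> units k;
  BG_abelian : abelian BG_grp;
  BG_normal : (BG_grp <| [set: G])%g;
  BG_coprime : coprime #|BG_grp| p;
  BG_bilinear : bimultiplicative BG_form;
  BG_alternating : form_alternating BG_form;
  BG_nondegenerate : form_nondegenerate BG_form;
  BG_invariant : conj_invariant BG_normal BG_form
}.

Lemma charGrp_triv (chi : charGrp k (1%G : {group G})) : chi = 1%g.
Proof.
apply/val_inj/ffunP=> x; rewrite ffunE.
have -> : x = 1%g by apply/val_inj; have := subgP x; rewrite inE => /eqP.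
have /charGrp_predP/(_ 1%g 1%g) := valP chi; rewrite mulg1 => e.
by apply: (mulgI (val chi 1%g)); rewrite -e mulg1.
Qed.

Lemma BG_one_coprime : coprime #|(1%G : {group G})| p.
Proof. by rewrite cards1 coprime1n. Qed.

Lemma BG_one_bilinear :
  bimultiplicative (fun _ _ : charGrp k (1%G : {group G}) => 1%g : units k).
Proof. by split=> x y z; rewrite mulg1. Qed.

Lemma BG_one_nondegenerate :
  form_nondegenerate (fun _ _ : charGrp k (1%G : {group G}) => 1%g : units k).
Proof. by split=> x _; apply: charGrp_triv. Qed.

Definition BG_one : BG := {|
  BG_abelian := abelian1 G;
  BG_normal := normal1 [set: G]%G;
  BG_coprime := BG_one_coprime;
  BG_bilinear := BG_one_bilinear;
  BG_alternating := fun=> erefl;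
  BG_nondegenerate := BG_one_nondegenerate;
  BG_invariant := fun _ _ _ => erefl
|}.
End Bset.

Section IntInn.
Variables (k : fieldType) (G : finGroupType).

Definition Inn_group : {group {perm G}} := (conj_aut [set: G] @* [set: G])%G.

Definition Int_set : {set {perm G}} :=
  [set s in Aut [set: G] | `[< exists2 u : grpAlg k G, u \is a GRing.unit &
     forall g, u * ga_delta k g * u^-1 = ga_delta k (s g) >]].

Lemma Int_group_set : group_set Int_set.
Proof.
apply/group_setP; split.
  apply/setIdP; split; first exact: group1.
  apply/asboolP; exists 1 => [|g]; first exact: unitr1.
  by rewrite perm1 invr1 mulr1 mul1r.
move=> s t /setIdP[sA /asboolP[u uu us]] /setIdP[tA /asboolP[v uv vt]].
apply/setIdP; split; first exact: groupM.
apply/asboolP; exists (v * u) => [|g]; first by rewrite unitrMr.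
by rewrite permM -vt -us invrM // !mulrA.
Qed.

Canonical Int_group : {group {perm G}} := Group Int_group_set.

Lemma Inn_normal_Int : (Inn_group <| Int_group)%g.
Proof.
have InnP (s : {perm G}) : reflect (exists g, forall x, s x = (x ^ g)%g) (s \in Inn_group).
  apply: (iffP morphimP) => [[g _ _ ->]|[g sg]].
    by exists g => x; rewrite conj_autE ?inE.
  exists g; first by rewrite (fintype.subsetP (normG _)) ?finset.in_setT.
    exact: finset.in_setT.
  by apply/permP=> x; rewrite sg conj_autE ?inE.
apply/andP; split.
  apply/fintype.subsetP=> s sI; apply/setIdP; split.
    exact: (fintype.subsetP (Aut_conj_aut _ _)) sI.
  case/InnP: sI => g sg; apply/asboolP.
  have ug : ga_delta k g^-1%g \is a GRing.unit.
    by apply/unitrP; exists (ga_delta k g); rewrite -!ga_deltaM mulVg mulgV.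
  exists (ga_delta k g^-1%g) => // x; apply: (mulIr ug); rewrite mulrVK //.
  by rewrite -!ga_deltaM sg conjgE -!mulgA mulgV mulg1.
apply/fintype.subsetP=> s /setIdP[sA _]; rewrite inE; apply/fintype.subsetP=> _ /imsetP[t /InnP[g tg] ->].
apply/InnP; exists (s g) => x.
rewrite /conjg !permM tg.
have sM : {morph s : x y / (x * y)%g}.
  by move=> y z; case/setIdP: sA => _ /morphicP; apply; rewrite inE.
have sV y : (s y^-1 = (s y)^-1)%g.
  apply: (mulgI (s y)); rewrite -sM !mulgV.
  by apply: (mulgI (s 1%g)); rewrite -sM !mulg1.
by rewrite !conjgE !sM sV permKV.
Qed.

End IntInn.

Section Subgroups.
Variable H : groupType.
Local Open Scope classical_set_scope.

Definition is_subgroup (S : set H) :=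
  [/\ S 1%g, forall x y, S x -> S y -> S (x * y)%g & forall x, S x -> S x^-1%g].

Definition left_coset (x : H) (S : set H) : set H := [set (x * y)%g | y in S].

Definition isog_fin (S : set H) (rT : finGroupType) (K : {group rT}) :=
  exists2 f : H -> rT, set_bij S [set` K] f &
    forall x y, S x -> S y -> f (x * y)%g = (f x * f y)%g.

End Subgroups.

(* Main.v *)
Require Import Defs.
From mathcomp Require Import all_boot all_order all_fingroup all_algebra all_field.
From mathcomp Require Import boolp classical_sets functions.
From HB Require Import structures.
From mathcomp Require Import cyclic.

(** Let F be an invariant twist and put R = F_21 F^-1.

    The twist equation and the invariance of F give R_21 = R^-1 and the hexagon
    identity (Delta (x) id) R = R_13 R_23 ([comul_id_rmatrix]).  Read on
    coefficients, the hexagon says that the rows of R, seen as elements of k[G],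
    are orthogonal idempotents; their sum is 1, and the columns are orthogonal
    idempotents as well.  The span of the rows is then the group algebra of the
    set A of the group elements that occur in R.  As it is commutative and reduced,
    A is an abelian subgroup of order prime to p; it is normal because R is
    invariant ([rsupp_group], [rsupp_abelian], [rsupp_normal], [rsupp_card]).
    Evaluating R at pairs of characters of A gives a form b on the dual of A:
    it is bimultiplicative by the hexagon, and nondegenerate because every element
    of A indexes a nonzero row.

    That b is alternating, and not only antisymmetric, uses that R comes from a
    twist.  Put D = F Delta, a coassociative map on k[G].  For the product dual
    to D, functions on G commute up to the values of b, so that b(chi, chi) <> 1
    makes the functions of degree chi square to zero.  The elements of k[G]
    on which all of them act by zero form a nonzero right ideal J with D(J)
    inside J (x) J.  A dimension count ([right_subcoalgebra_full]) shows that such a J is all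
    of k[G], which is absurd ([no_odd_component], [pair_ev_alt]).

    Characters of A separate the elements of k[A] (x) k[A], hence R and the pair
    (A, b) determine each other ([has_form_inj], [has_form_unique]), and Theta
    maps the class of F to (A, b).  Two twists F and F' have the same R exactly
    when F^-1 F' is symmetric ([rmatrix_eqP]); this makes the fibres of Theta the
    left cosets of the subgroup formed by the classes of symmetric twists.

    If F is symmetric, then D is cocommutative and the slices of D are commuting
    operators.  A common eigenvector, suitably scaled, is an element a with
    F Delta(a) = a (x) a, and the same dimension count, for the right ideal a k[G],
    shows that a is a unit ([symmetric_twist_coboundary]).  So F is the coboundary
    (a (x) a) Delta(a^-1), and its invariance says that conjugation by a maps the
    group-like elements of k[G], that is G, to themselves.  The coboundary lies
    in B^2 exactly when this automorphism of G is inner ([implements_B2]).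

    Finally, when A has odd order, b has the square root b^((|A|+1)/2), which is
    again an invariant bicharacter; up to exchanging its arguments it is the
    Fourier transform of an invariant twist with form b ([odd_has_form]).  In
    characteristic 2 an order prime to p is odd. *)

Set Implicit Arguments.
Unset Strict Implicit.
Unset Printing Implicit Defensive.

Import GRing.Theory.

(** * Commuting operators over an algebraically closed field *)

Section CommonEigenvector.
Import VectorInternalTheory.
Local Open Scope ring_scope.
Variable k : closedFieldType.

Lemma exists_eigenvector (vT : vectType k) (f : {linear vT -> vT}) (v0 : vT) :
  v0 != 0 -> exists a, exists2 v, v != 0 & f v = a *: v.
Proof.
move=> nv0; pose M := lin1_mx (v2r \o f \o r2v).
have [a] : exists a, root (char_poly M) a.
  apply/closed_rootP; rewrite size_char_poly eqSS; apply: contra_neq nv0 => d0.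
  by apply: (can_inj v2rK); apply/rowP=> i; have := ltn_ord i; rewrite {2}d0.
rewrite -eigenvalue_root_char => /eigenvalueP[w wM nw].
exists a; exists (r2v w); last first.
  by apply: (can_inj v2rK); have := wM; rewrite mul_rV_lin1 /= => ->; rewrite linearZ /= r2vK.
by apply: contra_neq nw => w0; rewrite -[w]r2vK w0 linear0.
Qed.

(** Induction on the list of operators: if W is nonzero and stable, the
    eigenvectors in W of the next operator for one of its eigenvalues form a
    nonzero subspace, which is stable because the operators commute. *)
Lemma common_eigenvector (vT : vectType k) (I : eqType) (T : I -> 'End(vT))
    (V : {vspace vT}) (r : seq I) :
  V != 0%VS -> (forall i, T i @: V <= V)%VS ->
  (forall i j v, T i (T j v) = T j (T i v)) ->
  exists2 v, v \in V & v != 0 /\ {in r, forall i, exists a, T i v = a *: v}.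
Proof.
move=> nV sV cT.
suff [W [nW _ WV hW]] : exists W : {vspace vT}, [/\ W != 0%VS,
    forall i, (T i @: W <= W)%VS, (W <= V)%VS &
    {in r, forall i, exists a, forall v, v \in W -> T i v = a *: v}].
  exists (vpick W); first exact: (subvP WV) (memv_pick W).
  split; first by rewrite vpick0.
  by move=> i /hW[a ha]; exists a; rewrite ha ?memv_pick.
elim: r => [|i r [W [nW sW WV hW]]]; first by exists V.
pose g : 'End(subvs_of W) := linfun (vsproj W \o T i \o vsval).
have gE u : vsval (g u) = T i (vsval u).
  by rewrite lfunE /= vsprojK //; apply/(subvP (sW i))/memv_img/subvsP.
have [a [u nu gu]] : exists a, exists2 u, u != 0 & g u = a *: u.
  apply: (@exists_eigenvector _ g (vsproj W (vpick W))).
  by rewrite -(inj_eq subvs_inj) vsprojK ?memv_pick // linear0 vpick0.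
have lE v : (v \in lker (T i - a *: \1%VF)) = (T i v == a *: v).
  by rewrite memv_ker add_lfunE opp_lfunE scale_lfunE id_lfunE subr_eq0.
exists (W :&: lker (T i - a *: \1%VF))%VS; split.
- apply: contra_neq nu => W0; apply: subvs_inj; rewrite linear0.
  apply/eqP; rewrite -memv0 -W0 memv_cap subvsP lE /=.
  by apply/eqP; rewrite -gE gu linearZ.
- move=> j; apply/subvP=> _ /memv_imgP[v vc ->]; have [vW] := memv_capP vc.
  rewrite lE => /eqP vi.
  rewrite memv_cap (subvP (sW j)) ?memv_img //= lE.
  by rewrite cT vi linearZ.
- exact: subv_trans (capvSl _ _) WV.
- move=> j; rewrite inE => /orP[/eqP ->|/hW[b hb]].
    by exists a => v /memv_capP[_]; rewrite lE => /eqP.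
  by exists b => v /memv_capP[vW _]; apply: hb.
Qed.

Lemma finite_common_eigenvector (vT : vectType k) (I : finType) (T : I -> 'End(vT))
    (V : {vspace vT}) :
  V != 0%VS -> (forall i, T i @: V <= V)%VS ->
  (forall i j v, T i (T j v) = T j (T i v)) ->
  exists2 v, v \in V & v != 0 /\ exists l, forall i, T i v = l i *: v.
Proof.
move=> nV sV cT; have [v vV [nv hv]] := common_eigenvector (enum I) nV sV cT.
exists v => //; split=> //; have h i : exists a, T i v = a *: v.
  by apply: hv; rewrite mem_enum.
by have [l hl] := choice h; exists l.
Qed.

End CommonEigenvector.

(** * Calculus in group algebras *)

Section GroupAlgebraCalculus.
Local Open Scope ring_scope.
Variable k : fieldType.
Implicit Types G H K : finGroupType.
Local Notation δ := (@ga_delta k _).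

Lemma sum_pair (V : nmodType) (I J : finType) (f : I * J -> V) :
  \sum_z f z = \sum_x \sum_y f (x, y).
Proof. by rewrite pair_bigA; apply: eq_bigr => -[]. Qed.

Lemma mulg_pair G H (a c : G) (b d : H) : ((a, b) * (c, d) = (a * c, b * d))%g.
Proof. by []. Qed.

Lemma invg_pair G H (a : G) (b : H) : ((a, b)^-1 = (a^-1, b^-1))%g.
Proof. by []. Qed.

Lemma ga_addE G (a b : grpAlg k G) x : (a + b) x = a x + b x :> k.
Proof. by rewrite ffunE. Qed.

Lemma ga_scaleE G (c : k) (a : grpAlg k G) x : (c *: a) x = c * a x.
Proof. by rewrite ffunE. Qed.

Lemma ga_sumE G I (r : seq I) (P : pred I) (f : I -> grpAlg k G) x :
  (\sum_(i <- r | P i) f i) x = \sum_(i <- r | P i) f i x :> k.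
Proof.
elim/big_rec2: _ => [|i y z _ <-]; first by rewrite ffunE.
by rewrite ga_addE.
Qed.

Lemma ga_deltaE G (g x : G) : δ g x = (x == g)%:R.
Proof. by rewrite ffunE. Qed.

Lemma ga_delta_mulE G (g : G) (a : grpAlg k G) x : (δ g * a) x = a (g^-1 * x)%g.
Proof.
rewrite ga_mulE (bigD1 g) //= ga_deltaE eqxx mul1r big1 ?addr0 // => y /negPf ny.
by rewrite ga_deltaE ny mul0r.
Qed.

Lemma ga_mul_deltaE G (g : G) (a : grpAlg k G) x : (a * δ g) x = a (x * g^-1)%g.
Proof.
rewrite ga_mulE (bigD1 (x * g^-1)%g) //= ga_deltaE invMg invgK mulgKV eqxx mulr1.
rewrite big1 ?addr0 // => y /negPf ny; rewrite ga_deltaE.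
rewrite (can2_eq (mulKVg y) (mulKg y)) -[x == _](can2_eq (mulgKV g) (mulgK g)).
by rewrite eq_sym ny mulr0.
Qed.

Lemma ga_delta_unit G (g : G) : δ g \is a GRing.unit.
Proof. by apply/unitrP; exists (δ g^-1%g); rewrite -!ga_deltaM mulVg mulgV. Qed.

Lemma ga_delta_inv G (g : G) : (δ g)^-1 = δ g^-1%g.
Proof.
by apply: (mulrI (ga_delta_unit g)); rewrite divrr ?ga_delta_unit // -ga_deltaM mulgV.
Qed.

Lemma ga_delta_inj G : injective (δ : G -> grpAlg k G).
Proof.
move=> g h /ffunP/(_ g)/eqP; rewrite !ga_deltaE eqxx.
by case: (g =P h) => // _; rewrite oner_eq0.
Qed.

Lemma ga_map_sum G H (f : G -> H) (a : grpAlg k G) :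
  ga_map f a = \sum_g a g *: δ (f g).
Proof.
rewrite {1}[a]ga_sum_delta linear_sum; apply: eq_bigr => g _.
by rewrite linearZ /= ga_map_delta.
Qed.

Lemma ga_map_comp G H K (f : H -> K) (g : G -> H) (a : grpAlg k G) :
  ga_map f (ga_map g a) = ga_map (f \o g) a.
Proof.
rewrite (ga_map_sum g) linear_sum ga_map_sum; apply: eq_bigr => x _.
by rewrite linearZ /= ga_map_delta.
Qed.

Lemma eq_ga_map G H (f g : G -> H) : f =1 g -> @ga_map k G H f =1 ga_map g.
Proof. by move=> e a; rewrite !ga_map_sum; apply: eq_bigr => x _; rewrite e. Qed.

Lemma ga_map_injE G H (f : G -> H) (a : grpAlg k G) g :
  injective f -> ga_map f a (f g) = a g.
Proof.
move=> fI; rewrite ffunE (big_pred1 g) // => x.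
by rewrite (inj_eq fI).
Qed.

Lemma ga_map_canE G H (f : G -> H) (f' : H -> G) (a : grpAlg k G) h :
  cancel f f' -> cancel f' f -> ga_map f a h = a (f' h).
Proof. by move=> fK f'K; rewrite -{1}[h]f'K ga_map_injE //; apply: can_inj fK. Qed.

Lemma ga_map_unit G H (f : G -> H) (a : grpAlg k G) :
  {morph f : x y / (x * y)%g} -> a \is a GRing.unit ->
  ga_map f a \is a GRing.unit.
Proof.
move=> fM ua; have f1 : f 1%g = 1%g by apply: (mulgI (f 1%g)); rewrite -fM !mulg1.
apply/unitrP; exists (ga_map f a^-1).
by rewrite -!ga_mapM // mulVr // mulrV // ga_map1.
Qed.

Lemma ga_mapV G H (f : G -> H) (a : grpAlg k G) :
  {morph f : x y / (x * y)%g} -> a \is a GRing.unit ->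
  ga_map f a^-1 = (ga_map f a)^-1.
Proof.
move=> fM ua; have f1 : f 1%g = 1%g by apply: (mulgI (f 1%g)); rewrite -fM !mulg1.
apply: (mulrI (ga_map_unit fM ua)).
by rewrite divrr ?ga_map_unit // -ga_mapM // mulrV // ga_map1.
Qed.

Lemma ga_map_mulE G H (f : G -> H) (a : grpAlg k G) (t : grpAlg k H) x :
  (ga_map f a * t) x = \sum_g a g * t ((f g)^-1 * x)%g.
Proof.
rewrite ga_map_sum mulr_suml ga_sumE; apply: eq_bigr => g _.
by rewrite -scalerAl ga_scaleE ga_delta_mulE.
Qed.

Lemma ga_mul_mapE G H (f : G -> H) (a : grpAlg k H) (t : grpAlg k G) x :
  (a * ga_map f t) x = \sum_g t g * a (x * (f g)^-1)%g.
Proof.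
rewrite ga_map_sum mulr_sumr ga_sumE; apply: eq_bigr => g _.
by rewrite -scalerAr ga_scaleE ga_mul_deltaE.
Qed.

Lemma ga_tens_unit G (a : grpAlg k G) :
  a \is a GRing.unit -> ga_tens a a \is a GRing.unit.
Proof.
move=> ua; apply/unitrP; exists (ga_tens a^-1 a^-1).
by rewrite -!ga_tensM mulVr // mulrV // ga_tens1.
Qed.

Lemma ga_tensV G (a : grpAlg k G) :
  a \is a GRing.unit -> ga_tens a^-1 a^-1 = (ga_tens a a)^-1.
Proof.
move=> ua; apply: (mulrI (ga_tens_unit ua)).
by rewrite divrr ?ga_tens_unit // -ga_tensM mulrV // ga_tens1.
Qed.

(** k[G] is finite-dimensional, so left multiplication by a right inverse [x] of
    [a], being injective, is onto; the preimage of 1 is [a] itself. *)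
Lemma ga_right_inverse_unit G (a : grpAlg k G) x : a * x = 1 -> a \is a GRing.unit.
Proof.
move=> ax; apply/unitrP; exists x; split=> //.
pose L : 'End(grpAlg k G) := amull x.
have LE y : L y = x * y by rewrite lfunE.
have kL : lker L == 0%VS.
  apply/eqP/vspaceP=> y; rewrite memv_ker LE memv0; apply/eqP/eqP=> [xy|->].
    by rewrite -[y]mul1r -ax -mulrA xy mulr0.
  by rewrite mulr0.
have : 1 \in limg L.
  suff -> : limg L = fullv by rewrite memvf.
  by apply/eqP; rewrite eqEdim subvf /= limg_dim_eq // (eqP kL) capv0.
case/memv_imgP=> y _; rewrite LE => e1.
by have -> : a = y by rewrite -[y]mul1r -ax -mulrA -e1 mulr1.
Qed.

End GroupAlgebraCalculus.

(** * Twisted coproducts and the dimension count *)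

Section Slices.
Local Open Scope ring_scope.
Variables (k : fieldType) (G H : finGroupType).
Implicit Types t : grpAlg k (G * H)%type.

(** In an element t of k[G] (x) k[H], row x is the second tensor factor
    standing next to the group element x, and column y the first one standing
    next to y. *)
Definition ga_row x t : grpAlg k H := [ffun y => t (x, y)].
Definition ga_col y t : grpAlg k G := [ffun x => t (x, y)].

Lemma ga_rowE t x y : ga_row x t y = t (x, y). Proof. by rewrite ffunE. Qed.
Lemma ga_colE t x y : ga_col y t x = t (x, y). Proof. by rewrite ffunE. Qed.

Lemma ga_row_linear x : linear (ga_row x).
Proof. by move=> c s t; apply/ffunP=> y; rewrite !ffunE. Qed.
Lemma ga_col_linear y : linear (ga_col y).
Proof. by move=> c s t; apply/ffunP=> x; rewrite !ffunE. Qed.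

HB.instance Definition _ x := GRing.isLinear.Build k (grpAlg k (G * H)%type)
  (grpAlg k H) _ (ga_row x) (ga_row_linear x).
HB.instance Definition _ y := GRing.isLinear.Build k (grpAlg k (G * H)%type)
  (grpAlg k G) _ (ga_col y) (ga_col_linear y).

Lemma ga_row_mul_delta t (u : G) (v : H) x :
  ga_row x (t * ga_delta k (u, v)) = ga_row (x * u^-1)%g t * ga_delta k v.
Proof. by apply/ffunP=> y; rewrite ga_rowE !ga_mul_deltaE ga_rowE. Qed.

Lemma ga_col_mul_delta t (u : G) (v : H) y :
  ga_col y (t * ga_delta k (u, v)) = ga_col (y * v^-1)%g t * ga_delta k u.
Proof. by apply/ffunP=> x; rewrite ga_colE !ga_mul_deltaE ga_colE. Qed.

End Slices.

Section TwistedCoproduct.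
Local Open Scope ring_scope.
Variables (k : fieldType) (G : finGroupType).
Implicit Types (a : grpAlg k G) (F t : grpAlg k (G * G)%type).
Local Notation δ := (@ga_delta k _).

Lemma comul_delta (g : G) : comul (δ g) = δ (g, g).
Proof. exact: ga_map_delta. Qed.

Lemma comul1 : comul (1 : grpAlg k G) = 1.
Proof. exact: comul_delta. Qed.

Lemma comul_unit a : a \is a GRing.unit -> comul a \is a GRing.unit.
Proof. exact: ga_map_unit. Qed.

Lemma comulV a : a \is a GRing.unit -> comul a^-1 = (comul a)^-1.
Proof. exact: ga_mapV. Qed.

Lemma comulE a (g h : G) : comul a (g, h) = (g == h)%:R * a g.
Proof.
rewrite [comul a]ga_map_sum ga_sumE (bigD1 g) //= big1 ?addr0 => [|x /negPf nx].
  by rewrite ga_scaleE ga_deltaE xpair_eqE eqxx /= mulrC eq_sym.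
by rewrite ga_scaleE ga_deltaE xpair_eqE eq_sym nx mulr0.
Qed.

Lemma comul_inj : injective (@comul k G).
Proof.
move=> a b /ffunP e; apply/ffunP=> g.
by have := e (g, g); rewrite !comulE eqxx !mul1r.
Qed.

Lemma tens_comul_idE F t h g z :
  (ga_tens F (1 : grpAlg k G) * comul_id t) (h, g, z)
  = (F * comul (ga_col z t)) (h, g).
Proof.
rewrite ![RHS]ga_mul_mapE ga_mul_mapE /=.
rewrite (eq_bigr (fun u => t (u.1, u.2) * (z == u.2)%:R * F (h * u.1^-1, g * u.1^-1)%g)).
  rewrite -(pair_bigA _ (fun x y => t (x, y) * (z == y)%:R * F (h * x^-1, g * x^-1)%g)) /=.
  apply: eq_bigr => x _; rewrite (bigD1 z) //= eqxx mulr1 big1 ?addr0 ?ga_colE // => y.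
  by rewrite eq_sym => /negPf ->; rewrite mulr0 mul0r.
case=> x y _ /=; rewrite ffunE /= ga_deltaE.
by rewrite -eq_mulgV1 -mulrA; congr (_ * _); rewrite mulrC.
Qed.

Lemma tens_id_comulE F t h g z :
  ga_assoc (ga_tens (1 : grpAlg k G) F * id_comul t) (h, g, z)
  = (F * comul (ga_row h t)) (g, z).
Proof.
rewrite [LHS](@ga_map_canE k _ _ _ (fun x => (x.1.1, (x.1.2, x.2)))) /=; last 2 first.
- by case=> ? [].
- by case=> -[].
rewrite ![RHS]ga_mul_mapE ga_mul_mapE /=.
rewrite (eq_bigr (fun u => t (u.1, u.2) * (h == u.1)%:R * F (g * u.2^-1, z * u.2^-1)%g)).
  rewrite -(pair_bigA _ (fun x y => t (x, y) * (h == x)%:R * F (g * y^-1, z * y^-1)%g)) /=.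
  rewrite (bigD1 h) //= [X in _ + X]big1 ?addr0 // => [|x].
    by apply: eq_bigr => y _; rewrite eqxx mulr1 ga_rowE.
  by rewrite eq_sym => /negPf ->; rewrite big1 // => y _; rewrite mulr0 mul0r.
by case=> x y _ /=; rewrite ffunE /= ga_deltaE -eq_mulgV1 -mulrA.
Qed.

(** The map D = F Delta is coassociative when F is a twist: both sides are
    coefficients at (h, g, z), of (id (x) D) D(x) and of (D (x) id) D(x). *)
Lemma twist_coassoc F x h g z : twist_condition F ->
  (F * comul (ga_row h (F * comul x))) (g, z)
  = (F * comul (ga_col z (F * comul x))) (h, g).
Proof.
move=> tF; rewrite -tens_comul_idE -tens_id_comulE comul_idM id_comulM.
have e : comul_id (comul x) = ga_assoc (id_comul (comul x)).
  by rewrite /comul_id /ga_assoc /id_comul /comul !ga_map_comp.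
by rewrite !mulrA tF ga_assocM -e.
Qed.

End TwistedCoproduct.

Section Torsor.
Local Open Scope ring_scope.
Variables (k : fieldType) (G : finGroupType).
Local Notation A := (grpAlg k G).
Local Notation δ := (@ga_delta k _).
Variables (F : grpAlg k (G * G)%type) (J : {vspace A}).
Hypothesis uF : F \is a GRing.unit.
Hypothesis idealJ : forall x g, x \in J -> x * δ g \in J.

(** With D = F Delta, the map x (x) g |-> D(x) (g (x) 1) is a linear
    automorphism of k[G] (x) k[G].  It sends J (x) k[G] into itself, hence onto
    itself by dimension, and also into k[G] (x) J.  So J (x) k[G] is contained in
    k[G] (x) J, and a nonzero J must be everything. *)
Lemma right_subcoalgebra_full :
  J != 0%VS ->
  (forall x g, x \in J -> ga_row g (F * comul x) \in J) ->
  (forall x g, x \in J -> ga_col g (F * comul x) \in J) ->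
  forall y, y \in J.
Proof.
move=> nJ rowJ colJ.
pose C : {vspace grpAlg k (G * G)%type} :=
  (\bigcap_(g : G) (linfun (ga_col (H:=G) g) @^-1: J))%VS.
have CP t : reflect (forall g, ga_col g t \in J) (t \in C).
  apply: (iffP idP) => [tC g|tJ].
    have : t \in (linfun (ga_col (H:=G) g) @^-1: J)%VS.
      by apply: (subvP _ _ tC); apply: bigcapv_inf.
    by rewrite -memv_preim lfunE.
  rewrite memvE; apply/subv_bigcapP=> g _; rewrite -memvE -memv_preim lfunE /=.
  exact: tJ.
pose kap (z : G * G) : G * G := (z.1 * z.2, z.1)%g.
pose kap' (z : G * G) : G * G := (z.2, z.2^-1 * z.1)%g.
have kapK : cancel kap kap' by case=> x y; rewrite /kap /kap' /= mulKg.
have kap'K : cancel kap' kap by case=> x y; rewrite /kap /kap' /= mulKVg.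
pose P : 'End(grpAlg k (G * G)%type) := (amull F \o linfun (ga_map kap))%VF.
have PE t : P t = F * ga_map kap t by rewrite /P comp_lfunE !lfunE.
have kP : (C :&: lker P = 0)%VS.
  suff -> : lker P = 0%VS by rewrite capv0.
  apply/vspaceP=> t; rewrite memv_ker memv0 PE; apply/eqP/eqP => [e|->].
    have {}e : ga_map kap t = 0 by apply: (mulrI uF); rewrite mulr0.
    apply/ffunP=> z; have := congr1 (fun a : grpAlg k (G * G)%type => a (kap z)) e.
    by rewrite ga_map_injE ?ffunE //; apply: can_inj kapK.
  by rewrite linear0 mulr0.
(* on group elements, [kap] is x (x) g |-> Delta(x) (g (x) 1) *)
have PC t : P t = \sum_g F * comul (ga_col g t) * δ (g, 1%g).
  rewrite PE ga_map_sum mulr_sumr.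
  rewrite (eq_bigr (fun z => t (z.1, z.2) *: (F * δ (kap (z.1, z.2))))); last first.
    by case=> x y _; rewrite -scalerAr.
  rewrite -(pair_bigA _ (fun x y => t (x, y) *: (F * δ (kap (x, y))))) exchange_big /=.
  apply: eq_bigr => g _; rewrite -mulrA [comul _]ga_map_sum mulr_suml mulr_sumr.
  apply: eq_bigr => x _; rewrite ga_colE -scalerAl -scalerAr; congr (_ *: (_ * _)).
  by rewrite -ga_deltaM /kap mulg_pair mulg1.
have PCr t g : t \in C -> ga_row g (P t) \in J.
  move/CP=> tC; rewrite PC linear_sum memv_suml // => h _ /=.
  by rewrite ga_row_mul_delta idealJ // rowJ.
have PCc t : t \in C -> P t \in C.
  move/CP=> tC; apply/CP=> g; rewrite PC linear_sum memv_suml // => h _ /=.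
  by rewrite ga_col_mul_delta idealJ // colJ.
have PCC : (P @: C)%VS = C.
  apply/eqP; rewrite eqEdim limg_dim_eq // leqnn andbT.
  by apply/subvP=> _ /memv_imgP[t tC ->]; apply: PCc.
have [g0 g0P] : exists g0, vpick J g0 != 0.
  apply/existsP; apply: contraR nJ; rewrite negb_exists => /forallP h.
  rewrite -vpick0; apply/eqP/ffunP=> g; rewrite [RHS]ffunE; apply/eqP.
  by have := h g; rewrite negbK.
move=> y.
have tC : ga_tens (vpick J) y \in C.
  apply/CP=> g; suff -> : ga_col g (ga_tens (vpick J) y) = y g *: vpick J.
    by rewrite memvZ // memv_pick.
  by apply/ffunP=> x; rewrite ga_colE !ffunE mulrC.
move: tC; rewrite -PCC => /memv_imgP[t tC e].
have := PCr t g0 tC; rewrite -e.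
have -> : ga_row g0 (ga_tens (vpick J) y) = (vpick J g0 : k) *: y.
  by apply/ffunP=> x; rewrite ga_rowE !ffunE.
by move=> h; have := memvZ (vpick J g0 : k)^-1 h; rewrite scalerA mulVf // scale1r.
Qed.

End Torsor.

(** * Slices of a twisted coproduct, and symmetric twists *)

Section Slicing.
Local Open Scope ring_scope.
Variables (k : fieldType) (G : finGroupType).
Implicit Types (a e : grpAlg k G) (F t : grpAlg k (G * G)%type).
Local Notation δ := (@ga_delta k _).

Definition swap : grpAlg k (G * G)%type -> grpAlg k (G * G)%type :=
  ga_map (fun x => (x.2, x.1)).

HB.instance Definition _ := GRing.Linear.on swap.

Lemma swapE t x y : swap t (x, y) = t (y, x).
Proof. by rewrite [swap t _](@ga_map_canE k _ _ _ (fun x => (x.2, x.1))) //; case. Qed.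

Lemma swapM : {morph swap : s t / s * t}.
Proof. exact: ga_mapM. Qed.

Lemma swap1 : swap 1 = 1. Proof. exact: ga_map1. Qed.

Lemma swapK : involutive swap.
Proof. by move=> t; apply/ffunP=> -[x y]; rewrite !swapE. Qed.

Lemma swap_unit t : t \is a GRing.unit -> swap t \is a GRing.unit.
Proof. exact: ga_map_unit. Qed.

Lemma swapV t : t \is a GRing.unit -> swap t^-1 = (swap t)^-1.
Proof. exact: ga_mapV. Qed.

Lemma swap_comul a : swap (comul a) = comul a.
Proof.
by apply/ffunP=> -[x y]; rewrite swapE !comulE eq_sym; case: eqP => [->|]; rewrite ?mul0r.
Qed.

Lemma swap_tens a e : swap (ga_tens a e) = ga_tens e a.
Proof. by apply/ffunP=> -[x y]; rewrite swapE !ffunE /= mulrC. Qed.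

Lemma ga_tens_mulE a e t g h :
  (ga_tens a e * t) (g, h) = \sum_u \sum_v a u * (e v * t (u^-1 * g, v^-1 * h)%g).
Proof.
rewrite ga_mulE pair_bigA /=; apply: eq_bigr => -[u v] _.
by rewrite ffunE /= mulrA.
Qed.

Lemma ga_tens1_mulE a t g h :
  (ga_tens a 1 * t) (g, h) = \sum_u a u * t (u^-1 * g, h)%g.
Proof.
rewrite ga_tens_mulE; apply: eq_bigr => u _.
rewrite (bigD1 1%g) //= ga_deltaE eqxx mul1r invg1 mul1g.
rewrite big1 ?addr0 // => v /negPf nv.
by rewrite ga_deltaE nv mul0r mulr0.
Qed.

Lemma ga_row_tens1_mul a t h :
  ga_row h (ga_tens a 1 * t) = \sum_u (a u : k) *: ga_row (u^-1 * h)%g t.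
Proof.
apply/ffunP=> z; rewrite ga_rowE ga_tens1_mulE ga_sumE; apply: eq_bigr => u _.
by rewrite ga_scaleE ga_rowE.
Qed.

(** Under the duality between k[G] and functions, the slice at h is the transpose
    of left multiplication by the function x |-> e (h * x^-1), for the product of
    functions dual to F Delta. *)
Definition slice F e h : 'End(grpAlg k G) :=
  (linfun (ga_row h) \o (amull (ga_tens e 1 * F) \o linfun (@comul k G)))%VF.

Lemma sliceE F e h x : slice F e h x = ga_row h (ga_tens e 1 * (F * comul x)).
Proof. by rewrite /slice !comp_lfunE !lfunE /= mulrA. Qed.

(** By coassociativity, two successive slices are one slice of the iterated
    coproduct. *)
Lemma slice_slice F e g h x z : twist_condition F ->
  slice F e g (slice F e h x) z
  = (ga_tens e e * (F * comul (ga_col z (F * comul x)))) (h, g).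
Proof.
move=> tF; rewrite (sliceE F e g) ga_rowE ga_tens1_mulE ga_tens_mulE exchange_big /=.
apply: eq_bigr => u _; rewrite sliceE ga_row_tens1_mul linear_sum mulr_sumr ga_sumE.
rewrite mulr_sumr; apply: eq_bigr => v _.
by rewrite linearZ -scalerAr ga_scaleE twist_coassoc // mulrCA.
Qed.

(** Exchanging the two slices amounts to multiplying by [R], which acts on
    [e (x) e] as the scalar [c]. *)
Lemma slice_comm F R e (c : k) g h x : twist_condition F ->
  swap F = R * F -> ga_tens e e * R = c *: ga_tens e e ->
  slice F e g (slice F e h x) = c *: slice F e h (slice F e g x).
Proof.
move=> tF FR eR; apply/ffunP=> z; rewrite slice_slice // ga_scaleE slice_slice //.
rewrite -swapE swapM swap_tens swapM swap_comul FR -!mulrA mulrA eR.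
by rewrite -scalerAl ga_scaleE.
Qed.

Lemma slice1E F h x : slice F 1 h x = ga_row h (F * comul x).
Proof. by rewrite sliceE ga_tens1 mul1r. Qed.

End Slicing.

Section Symmetric.
Local Open Scope ring_scope.
Variables (k : closedFieldType) (G : finGroupType).
Variable F : grpAlg k (G * G)%type.
Local Notation δ := (@ga_delta k _).
Hypotheses (uF : F \is a GRing.unit) (tF : twist_condition F).

(** The right ideal a k[G] is spanned by the elements a g, for which
    F Delta(a g) = a g (x) a g; so it is everything by the dimension count. *)
Lemma twisted_grouplike_unit a : a != 0 -> F * comul a = ga_tens a a ->
  a \is a GRing.unit.
Proof.
move=> na Fa; pose J := limg (amull a).
have JP y : reflect (exists x, y = a * x) (y \in J).
  apply: (iffP memv_imgP) => [[x _ ->]|[x ->]]; exists x; rewrite ?memvf //.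
    by rewrite lfunE.
  by rewrite lfunE.
have D x : F * comul (a * x) = \sum_g (x g : k) *: ga_tens (a * δ g) (a * δ g).
  rewrite comulM mulrA Fa [comul x]ga_map_sum mulr_sumr; apply: eq_bigr => g _.
  by rewrite -scalerAr -ga_tens_delta -ga_tensM.
have : 1 \in J.
  apply: (right_subcoalgebra_full uF) => [y g /JP[x ->]||y g /JP[x ->]|y g /JP[x ->]].
  - by apply/JP; exists (x * δ g); rewrite mulrA.
  - apply: contra_neq na => J0; apply/eqP; rewrite -memv0 -J0.
    by apply/JP; exists 1; rewrite mulr1.
  - rewrite D linear_sum memv_suml // => h _; rewrite linearZ memvZ //=.
    apply/JP; exists ((a * δ h) g *: δ h); rewrite -scalerAr.
    by apply/ffunP=> z; rewrite ga_rowE ga_scaleE [LHS]ffunE.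
  - rewrite D linear_sum memv_suml // => h _; rewrite linearZ memvZ //=.
    apply/JP; exists ((a * δ h) g *: δ h); rewrite -scalerAr.
    by apply/ffunP=> z; rewrite ga_colE ga_scaleE [LHS]ffunE mulrC.
by case/JP=> x /esym /ga_right_inverse_unit.
Qed.

(** The slices x |-> row g of F Delta(x) commute.  If a is a common eigenvector
    with eigenvalues l g, then F Delta(a) = l (x) a is symmetric, which makes l
    proportional to a. *)
Lemma symmetric_twist_coboundary : swap F = F ->
  exists2 a, a \is a GRing.unit & F * comul a = ga_tens a a.
Proof.
move=> sF.
have full0 : fullv != 0%VS :> {vspace grpAlg k G}.
  apply/eqP=> f0; have := memvf (1 : grpAlg k G); rewrite f0 memv0.
  by rewrite oner_eq0.
have [|g h v|a _ [na [l hl]]] := finite_common_eigenvector (T := slice F 1) full0.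
- by move=> g; apply: subvf.
- by rewrite (slice_comm (R := 1) (c := 1)) ?scale1r ?mul1r ?mulr1.
have Dl g z : (F * comul a) (g, z) = l g * a z.
  by rewrite -ga_rowE -slice1E hl ga_scaleE.
have lC g z : l g * a z = l z * a g.
  by rewrite -!Dl -swapE swapM swap_comul sF.
have [z0 az0] : exists z0, a z0 != 0.
  apply/existsP; apply: contraR na; rewrite negb_exists => /forallP h.
  by apply/eqP/ffunP=> g; rewrite [RHS]ffunE; apply/eqP; have := h g; rewrite negbK.
pose c := l z0 / a z0.
have lE g : l g = c * a g.
  by rewrite /c mulrAC -lC mulfK.
have Da : F * comul (c *: a) = ga_tens (c *: a) (c *: a).
  apply/ffunP=> -[g z]; rewrite linearZ -scalerAr ga_scaleE Dl lE.
  by rewrite [RHS]ffunE /= !ga_scaleE mulrCA.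
exists (c *: a) => //; apply: twisted_grouplike_unit => //.
rewrite scaler_eq0 (negPf na) orbF; apply: contra_neq na => c0.
apply: (@comul_inj k G); rewrite linear0; apply: (mulrI uF); rewrite mulr0.
by apply/ffunP=> -[g z]; rewrite Dl lE c0 !mul0r ffunE.
Qed.

(** The slices by [e] commute up to the scalar [c]; as [c != 1] they square to
    zero, so that their common kernel J is nonzero.  J consists of the x with
    (e (x) 1) F Delta(x) = 0; the dimension count makes it contain 1, so that
    (e (x) 1) F = 0. *)
Lemma no_odd_component R (e : grpAlg k G) (c : k) :
  swap F = R * F -> ga_tens e 1 * R = R * ga_tens e 1 ->
  ga_tens e e * R = c *: ga_tens e e -> c != 1 -> e = 0.
Proof.
move=> FR eR eeR nc1.
have sc g h x : slice F e g (slice F e h x) = c *: slice F e h (slice F e g x).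
  exact: (slice_comm g h x tF FR eeR).
(* apply in turn each slice that does not kill the vector obtained so far *)
have [x0 nx0 hx0] : exists2 x, x != 0 & forall g, slice F e g x = 0.
  suff [x nx hx] : exists2 x, x != 0 &
      forall g, g \in enum G -> slice F e g x = 0.
    by exists x => // g; apply: hx; rewrite mem_enum.
  elim: (enum G) => [|g r [x nx hx]]; first by exists 1; rewrite ?oner_eq0.
  have [e0|ne0] := eqVneq (slice F e g x) 0.
    by exists x => // h; rewrite inE => /orP[/eqP ->|/hx].
  exists (slice F e g x) => // h; rewrite inE => /orP[/eqP ->|/hx e0]; last first.
    by rewrite sc e0 linear0 scaler0.
  apply/eqP; have /eqP := sc g g x.
  by rewrite -subr_eq0 -{1}[slice F e g _]scale1r -scalerBl scaler_eq0 subr_eq0 eq_sym (negPf nc1).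
pose J : {vspace grpAlg k G} := (\bigcap_(g : G) lker (slice F e g))%VS.
have JP x : reflect (forall g, slice F e g x = 0) (x \in J).
  apply: (iffP idP) => [xJ g|xJ].
    by apply/eqP; rewrite -memv_ker; apply: (subvP _ _ xJ); apply: bigcapv_inf.
  by rewrite memvE; apply/subv_bigcapP=> g _; rewrite -memvE memv_ker xJ.
have JP' x : reflect (ga_tens e 1 * (F * comul x) = 0) (x \in J).
  apply: (iffP (JP x)) => h; last by move=> g; rewrite sliceE h linear0.
  by apply/ffunP=> -[g z]; rewrite -ga_rowE -sliceE h !ffunE.
have colJ x g : x \in J -> ga_col g (F * comul x) \in J.
  move=> /JP' hx; apply/JP'; apply/ffunP=> -[h z]; rewrite ga_tens1_mulE [RHS]ffunE.
  under eq_bigr do rewrite -twist_coassoc //.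
  have /(congr1 (fun t => (F * comul t) (z, g))) : ga_row h (ga_tens e 1 * (F * comul x)) = 0.
    by rewrite hx linear0.
  rewrite linear0 mulr0 ga_row_tens1_mul linear_sum mulr_sumr ga_sumE ffunE => h0.
  by rewrite -[RHS]h0; apply: eq_bigr => u _; rewrite linearZ -scalerAr ga_scaleE.
have full : forall y, y \in J.
  apply: (right_subcoalgebra_full uF) => // [x g /JP' hx||x g xJ].
  - by apply/JP'; rewrite comulM !mulrA -(mulrA _ F) hx mul0r.
  - by apply: contra_neq nx0 => J0; apply/eqP; rewrite -memv0 -J0; apply/JP.
  - apply/JP'; apply/ffunP=> -[h z]; rewrite ga_tens1_mulE [RHS]ffunE.
    under eq_bigr do rewrite twist_coassoc // -swapE swapM swap_comul FR.
    have /JP' := colJ x z xJ => /(congr1 (fun t => R * t)).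
    rewrite mulr0 mulrA -eR -mulrA => /(congr1 (fun t : grpAlg k (G * G)%type => t (h, g))).
    by rewrite ga_tens1_mulE [X in _ = X]ffunE mulrA.
have := JP' _ (full 1); rewrite comul1 mulr1 => eF.
have e0 : ga_tens e (1 : grpAlg k G) = 0 by apply: (mulIr uF); rewrite eF mul0r.
apply/ffunP=> g; have := congr1 (fun t : grpAlg k (G * G)%type => t (g, 1%g)) e0.
by rewrite ffunE /= ga_deltaE eqxx mulr1 => ->; rewrite !ffunE.
Qed.

End Symmetric.

(** * The R-matrix of an invariant twist *)

Section RMatrix.
Local Open Scope ring_scope.
Variables (k : fieldType) (G : finGroupType).
Local Notation δ := (@ga_delta k _).
Implicit Types (F S : grpAlg k (G * G)%type).

Definition rmatrix F := swap F * F^-1.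

Lemma ga_tens_1r F : ga_tens F (1 : grpAlg k G) = ga_map (fun x : G * G => (x.1, x.2, 1%g)) F.
Proof.
apply/esym; rewrite ga_map_sum {2}[F]ga_sum_delta; apply/ffunP=> -[x z].
rewrite [RHS]ffunE /= ga_sumE [in RHS]ga_sumE mulr_suml; apply: eq_bigr => -[a b] _.
by rewrite !ga_scaleE -mulrA; congr (_ * _); rewrite !ga_deltaE xpair_eqE -natrM mulnb.
Qed.

Lemma ga_tens_1l F : ga_assoc (ga_tens (1 : grpAlg k G) F)
  = ga_map (fun x : G * G => (1%g, x.1, x.2)) F.
Proof.
apply/esym; rewrite -[RHS](congr1 _ (_ : ga_map (fun x : G * G => (1%g : G, x)) F = _)).
  by rewrite /ga_assoc ga_map_comp; apply: eq_ga_map.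
rewrite ga_map_sum {2}[F]ga_sum_delta; apply/ffunP=> -[x z].
rewrite [RHS]ffunE /= ga_sumE [in RHS]ga_sumE mulr_sumr; apply: eq_bigr => -[a b] _.
by rewrite !ga_scaleE mulrCA; congr (_ * _); rewrite !ga_deltaE xpair_eqE -natrM mulnb.
Qed.

Let i12 (x : G * G) : G * G * G := (x.1, x.2, 1%g).
Let i13 (x : G * G) : G * G * G := (x.1, 1%g, x.2).
Let i23 (x : G * G) : G * G * G := (1%g, x.1, x.2).

Let i12M : {morph i12 : x y / (x * y)%g}.
Proof. by case=> a b [c d]; rewrite /i12 /= -{1}[1%g]mulg1. Qed.
Let i13M : {morph i13 : x y / (x * y)%g}.
Proof. by case=> a b [c d]; rewrite /i13 /= -{1}[1%g]mulg1. Qed.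
Let i23M : {morph i23 : x y / (x * y)%g}.
Proof. by case=> a b [c d]; rewrite /i23 /= -{1}[1%g]mulg1. Qed.

Let i12E F : ga_map i12 F = ga_tens F 1.
Proof. by rewrite ga_tens_1r. Qed.

Let i23E F : ga_map i23 F = ga_assoc (ga_tens 1 F).
Proof. by rewrite ga_tens_1l. Qed.

Section Twist.
Variable F : grpAlg k (G * G)%type.
Hypotheses (uF : F \is a GRing.unit) (iF : comul_invariant F) (tF : twist_condition F).
Let R := rmatrix F.

Lemma rmatrix_unit : R \is a GRing.unit.
Proof. by rewrite unitrMr ?unitrV ?swap_unit. Qed.

Lemma rmatrixK : R * F = swap F.
Proof. by rewrite /R /rmatrix mulrVK. Qed.

(** F_21 is invariant along with F because Delta is cocommutative. *)
Lemma rmatrix_invariant : comul_invariant R.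
Proof.
apply: invariantM; last exact: invariantV.
by move=> a; rewrite -{1}swap_comul -swapM iF swapM swap_comul.
Qed.

Lemma swap_rmatrix : swap R = R^-1.
Proof. by rewrite /R /rmatrix swapM swapK swapV // invrM ?invrK ?unitrV ?swap_unit. Qed.

(** Write the twist equation as F_12 X = F_23 Y with X = (Delta (x) id) F and
    Y = (id (x) Delta) F.  By cocommutativity, permuting the three factors yields
    two further relations, in which the same element X' and the same Y occur:
    F_31 X' = F_12 (Delta (x) id) F_21 and F_13 X' = F_32 Y.  Eliminating X' and Y
    expresses (Delta (x) id) R as the conjugate of R_13 R_23 by F_12, and F_12
    commutes with (Delta (x) id) R by invariance. *)
Lemma comul_id_rmatrix : comul_id R = ga_map i13 R * ga_map i23 R.
Proof.
pose Y := ga_map (fun x : G * G => (x.1, x.2, x.2)) F.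
pose X' := ga_map (fun x : G * G => (x.1, x.2, x.1)) F.
have phi : ga_map i12 F * comul_id F = ga_map i23 F * Y.
  by rewrite i12E i23E tF ga_assocM; congr (_ * _); rewrite /ga_assoc /id_comul ga_map_comp.
pose s (x : G * G * G) : G * G * G := (x.1.2, x.2, x.1.1).
pose t (x : G * G * G) : G * G * G := (x.1.1, x.2, x.1.2).
have sM : {morph s : x y / (x * y)%g} by case=> -[a b] c [[a' b'] c'].
have tM : {morph t : x y / (x * y)%g} by case=> -[a b] c [[a' b'] c'].
have phis : ga_map i13 (swap F) * X' = ga_map i12 F * comul_id (swap F).
  have := congr1 (ga_map s) phi; rewrite !(ga_mapM sM) /comul_id /Y /swap !ga_map_comp.
  by move=> e; rewrite -[RHS]/(_ * _) -e.
have phit : ga_map i13 F * X' = ga_map i23 (swap F) * Y.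
  have := congr1 (ga_map t) phi; rewrite !(ga_mapM tM) /comul_id /Y /swap !ga_map_comp.
  by move=> e; rewrite -[RHS]/(_ * _) -e.
have u12 := ga_map_unit i12M uF; have u13 := ga_map_unit i13M uF.
have u23 := ga_map_unit i23M uF.
have uX : comul_id F \is a GRing.unit by apply: ga_map_unit.
have e13 : ga_map i13 R * ga_map i13 F = ga_map i13 (swap F).
  by rewrite -(ga_mapM i13M) rmatrixK.
have e23 : ga_map i23 R * ga_map i23 F = ga_map i23 (swap F).
  by rewrite -(ga_mapM i23M) rmatrixK.
apply: (mulIr u12); apply: (mulIr uX); rewrite i12E comul_id_comm // -i12E.
rewrite -(mulrA _ (comul_id R)) -comul_idM rmatrixK -phis -e13.
by rewrite -!mulrA phi phit -e23 -mulrA.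
Qed.

End Twist.

Let mul_i13_i23E S T x y z :
  (ga_map i13 S * ga_map i23 T) (x, y, z) = (ga_row x S * ga_row y T) z.
Proof.
have i23I : injective i23 by case=> a b [c d] [-> ->].
rewrite ga_map_mulE ga_mulE sum_pair.
rewrite /= (bigD1 x) //= [X in _ + X]big1 ?addr0 => [|a na].
  apply: eq_bigr => b _; rewrite !ga_rowE; congr (_ * _).
  rewrite -(ga_map_injE _ _ i23I); congr (ga_map _ _ _).
  by rewrite /i13 /i23 /= !invg_pair !mulg_pair mulVg invg1 mul1g.
rewrite big1 // => b _; rewrite [ga_map _ _ _]ffunE big_pred0 ?mulr0 // => -[c d].
apply/negbTE; apply: contra na; rewrite /i13 /i23 /= !invg_pair !mulg_pair.
by case/eqP=> /esym/eqP; rewrite -eq_mulVg1.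
Qed.

Let mul_i23_i13E S T x y z :
  (ga_map i23 T * ga_map i13 S) (x, y, z) = (ga_row y T * ga_row x S) z.
Proof.
have i13I : injective i13 by case=> a b [c d] [-> ->].
rewrite ga_map_mulE ga_mulE sum_pair.
rewrite /= (bigD1 y) //= [X in _ + X]big1 ?addr0 => [|a na].
  apply: eq_bigr => b _; rewrite !ga_rowE; congr (_ * _).
  rewrite -(ga_map_injE _ _ i13I); congr (ga_map _ _ _).
  by rewrite /i13 /i23 /= !invg_pair !mulg_pair mulVg invg1 mul1g.
rewrite big1 // => b _; rewrite [ga_map _ _ _]ffunE big_pred0 ?mulr0 // => -[c d].
apply/negbTE; apply: contra na; rewrite /i13 /i23 /= !invg_pair !mulg_pair.
by case/eqP=> _ /esym/eqP; rewrite -eq_mulVg1.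
Qed.

Lemma comul_idE S x y z : comul_id S (x, y, z) = (x == y)%:R * S (x, z).
Proof.
rewrite [comul_id S]ga_map_sum ga_sumE (bigD1 (x, z)) //= ga_scaleE ga_deltaE.
rewrite !xpair_eqE !eqxx andbT /= mulrC eq_sym big1 ?addr0 // => -[a b] nab.
rewrite ga_scaleE ga_deltaE !xpair_eqE /= in nab *.
by case: (x =P a) nab => [->|]; case: (z =P b) => [->|]; rewrite ?eqxx ?andbF ?mulr0.
Qed.

Section TwistRows.
Variable F : grpAlg k (G * G)%type.
Hypotheses (uF : F \is a GRing.unit) (iF : comul_invariant F) (tF : twist_condition F).
Let R := rmatrix F.

(** This is the hexagon identity, coefficient by coefficient. *)
Lemma rmatrix_rowM x y : ga_row x R * ga_row y R = (x == y)%:R *: ga_row x R.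
Proof.
apply/ffunP=> z; rewrite -mul_i13_i23E -comul_id_rmatrix // comul_idE.
by rewrite ga_scaleE ga_rowE.
Qed.

(** Inverting the hexagon identity gives one for R^-1 = R_21, whose rows are the
    columns of R. *)
Lemma rmatrix_colM x y : ga_col x R * ga_col y R = (x == y)%:R *: ga_col x R.
Proof.
have uR : R \is a GRing.unit by apply: rmatrix_unit.
have rowS z : ga_col z R = ga_row z (swap R).
  by apply/ffunP=> u; rewrite ga_rowE swapE ga_colE.
apply/ffunP=> z; rewrite !rowS -mul_i23_i13E swap_rmatrix //.
rewrite (ga_mapV i23M) // (ga_mapV i13M) // -invrM ?(ga_map_unit i23M) ?(ga_map_unit i13M) //.
rewrite -comul_id_rmatrix // -[(comul_id _)^-1](@ga_mapV k _ _ (fun x => (x.1, x.1, x.2))) //.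
rewrite [LHS]comul_idE -swap_rmatrix // ga_scaleE ga_rowE.
by rewrite eq_sym; case: eqP => [->|]; rewrite ?mul0r.
Qed.

(** The sum of the rows is idempotent, and it is a unit because it is the image of
    R under a morphism of algebras. *)
Lemma rmatrix_row_sum : \sum_x ga_row x R = 1.
Proof.
have rE : ga_map snd R = \sum_x ga_row x R.
  rewrite ga_map_sum sum_pair /=; apply: eq_bigr => x _; rewrite [RHS]ga_sum_delta.
  by apply: eq_bigr => y _; rewrite ga_rowE.
have uE : \sum_x ga_row x R \is a GRing.unit.
  by rewrite -rE; apply: ga_map_unit (rmatrix_unit uF).
apply: (mulrI uE); rewrite mulr1.
rewrite mulr_suml; apply: eq_bigr => x _; rewrite mulr_sumr (bigD1 x) //=.
rewrite rmatrix_rowM eqxx scale1r big1 ?addr0 // => y /negPf ny.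
by rewrite rmatrix_rowM eq_sym ny scale0r.
Qed.

(** The antipode applied to the first factor inverts R, by the orthogonality
    of the rows; the flip inverts R too. *)
Lemma rmatrix_flip x y : R (y, x) = R (x^-1, y)%g.
Proof.
have uR : R \is a GRing.unit by apply: rmatrix_unit.
pose R' : grpAlg k (G * G)%type := ga_map (fun z => (z.1^-1, z.2)%g) R.
have R'E a b : R' (a, b) = R (a^-1, b)%g.
  rewrite [LHS](@ga_map_canE k _ _ _ (fun z => (z.1^-1, z.2)%g)) //=.
    by case=> ? ? /=; rewrite invgK.
  by case=> ? ? /=; rewrite invgK.
suff R'R : R' * R = 1.
  by rewrite -R'E -swapE swap_rmatrix // -[R^-1]mul1r -R'R mulrK.
apply/ffunP=> -[g z]; rewrite ga_map_mulE sum_pair /=.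
rewrite (eq_bigr (fun a => (1%g == g)%:R * R (a, z))) => [|a _]; last first.
  have := rmatrix_rowM a (a * g)%g => /ffunP/(_ z); rewrite ga_mulE ga_scaleE ga_rowE.
  have -> : (a == (a * g)%g) = (1%g == g) by rewrite -{1}[a]mulg1 (inj_eq (mulgI a)).
  move=> <-.
  by apply: eq_bigr => b _; rewrite !ga_rowE invg_pair mulg_pair invgK.
rewrite -mulr_sumr; have := rmatrix_row_sum => /ffunP/(_ z); rewrite ga_sumE.
rewrite (eq_bigr (fun a => R (a, z))) => [->|a _]; last by rewrite ga_rowE.
by rewrite !ga_deltaE xpair_eqE -natrM mulnb eq_sym.
Qed.

Lemma rmatrix_conj g x y : R (x ^ g, y ^ g)%g = R (x, y).
Proof.
have := rmatrix_invariant uF iF (δ g^-1%g).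
rewrite comul_delta => /ffunP/(_ (g^-1 * x, g^-1 * y)%g).
rewrite ga_delta_mulE ga_mul_deltaE !invg_pair !mulg_pair !invgK !mulKVg => ->.
by rewrite !conjgE !mulgA.
Qed.

End TwistRows.

End RMatrix.

(** * The support of an R-matrix *)

Section Support.
Local Open Scope ring_scope.
Variables (k : fieldType) (G : finGroupType) (R : grpAlg k (G * G)%type).
Local Notation δ := (@ga_delta k _).
Hypothesis rowM : forall x y, ga_row x R * ga_row y R = (x == y)%:R *: ga_row x R.
Hypothesis colM : forall x y, ga_col x R * ga_col y R = (x == y)%:R *: ga_col x R.
Hypothesis row_sum : \sum_x ga_row x R = 1.
Hypothesis flip : forall x y, R (y, x) = R (x^-1, y)%g.
Hypothesis conj : forall g x y, R (x ^ g, y ^ g)%g = R (x, y).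

(** The same elements occur in R on the left, since R(y, x) = R(x^-1, y)
    ([rsupp_left]): this is the support of R on either side. *)
Definition rsupp : {set G} := [set y | [exists x, R (x, y) != 0]].

Lemma rsuppP y : reflect (exists x, R (x, y) != 0) (y \in rsupp).
Proof. by rewrite inE; apply: existsP. Qed.

Lemma rsupp_right x y : R (x, y) != 0 -> y \in rsupp.
Proof. by move=> xy; apply/rsuppP; exists x. Qed.

Lemma rsupp_left x y : R (x, y) != 0 -> x \in rsupp.
Proof. by rewrite flip => xy; apply/rsuppP; exists y^-1%g. Qed.

Let lin (c : G -> k) : grpAlg k G := \sum_h c h *: ga_row h R.

Let linM c d : lin c * lin d = lin (fun h => c h * d h).
Proof.
rewrite mulr_suml; apply: eq_bigr => x _; rewrite mulr_sumr (bigD1 x) //=.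
rewrite -scalerAl -scalerAr rowM eqxx scale1r scalerA big1 ?addr0 // => y /negPf ny.
by rewrite -scalerAl -scalerAr rowM eq_sym ny scale0r !scaler0.
Qed.

Let lin_supp c y : lin c y != 0 -> y \in rsupp.
Proof.
apply: contraR => ny; rewrite ga_sumE big1 // => h _; rewrite ga_scaleE ga_rowE.
by have [->|/rsupp_right] := eqVneq (R (h, y)) 0; rewrite ?mulr0 // (negPf ny).
Qed.

(** The product of the columns z and y takes at x the value R(x, y) if z = y, and 0
    otherwise.  Seen as a function of z, it is a combination of the rows. *)
Let delta_lin y : y \in rsupp -> exists c, δ y = lin c.
Proof.
case/rsuppP=> x nxy; exists (fun h => R (h^-1 * x, y)%g / R (x, y)).
apply/ffunP=> z; rewrite ga_deltaE ga_sumE.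
have := colM z y => /ffunP/(_ x); rewrite ga_mulE ga_scaleE ga_colE => e.
have {}e : \sum_h R (h, z) * R (h^-1 * x, y)%g = (z == y)%:R * R (x, y).
  have -> : (z == y)%:R * R (x, y) = (z == y)%:R * R (x, z) by case: eqP => [->|]; rewrite ?mul0r.
  by rewrite -e; apply: eq_bigr => h _; rewrite !ga_colE.
apply: (mulIf nxy); rewrite -e mulr_suml; apply: eq_bigr => h _.
by rewrite ga_scaleE ga_rowE mulrAC mulfVK // mulrC.
Qed.

(** The span of the rows is a subalgebra which involves only elements of the
    support, and by [delta_lin] it contains them all. *)
Lemma rsupp_group_set : group_set rsupp.
Proof.
apply/group_setP; split.
  apply/rsuppP; apply/existsP; have := row_sum => /ffunP/(_ 1%g).
  rewrite ga_deltaE eqxx ga_sumE => e; apply: contraPT e.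
  rewrite negb_exists => /forallP h; rewrite big1 => [/esym/eqP|x _]; first by rewrite oner_eq0.
  by rewrite ga_rowE; apply/eqP; have := h x; rewrite negbK.
move=> x y /delta_lin[c ec] /delta_lin[d ed].
apply: (@lin_supp (fun h => c h * d h)); rewrite -linM -ec -ed -ga_deltaM.
by rewrite ga_deltaE eqxx oner_eq0.
Qed.

Definition rsupp_group : {group G} := Group rsupp_group_set.

Lemma rsupp_abelian : abelian rsupp.
Proof.
apply/centsP=> x /delta_lin[c ec] y /delta_lin[d ed].
apply: (@ga_delta_inj k G); rewrite !ga_deltaM ec ed !linM.
by apply: eq_bigr => h _; rewrite mulrC.
Qed.

Lemma rsupp_normal : (rsupp <| [set: G])%g.
Proof.
rewrite /normal finset.subsetT; apply/fintype.subsetP=> g _; rewrite inE.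
apply/fintype.subsetP=> _ /imsetP[y /rsuppP[x nxy] ->].
by apply/rsuppP; exists (x ^ g)%g; rewrite conj.
Qed.

(** If |A| were zero in k, the sum of the elements of A would square to
    zero; but a nonzero combination of orthogonal idempotents has a nonzero
    square. *)
Lemma rsupp_card : #|rsupp|%:R != 0 :> k.
Proof.
apply/eqP=> A0; pose n : grpAlg k G := \sum_(y in rsupp) δ y.
have nn : n * n = 0.
  rewrite mulr_suml (eq_bigr (fun _ => n)) => [|y yA].
    by rewrite sumr_const -scaler_nat A0 scale0r.
  rewrite mulr_sumr [RHS](reindex_inj (mulgI y)).
  apply: eq_big => [x|x _]; last by rewrite ga_deltaM.
  by rewrite [RHS](groupMl x (yA : y \in rsupp_group)).
have [c ec] : exists c, n = lin c.
  have [c hc] : exists c : G -> G -> k, forall y, y \in rsupp -> δ y = lin (c y).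
    have h y : exists c, y \in rsupp -> δ y = lin c.
      by have [/delta_lin[c e]|] := boolP (y \in rsupp); [exists c|exists (fun => 0)].
    by have [c hc] := choice h; exists c.
  exists (fun h => \sum_(y in rsupp) c y h); rewrite /n /lin.
  under [RHS]eq_bigr do rewrite scaler_suml.
  by rewrite exchange_big /=; apply: eq_bigr => y yA; rewrite hc.
have c0 h : c h *: ga_row h R = 0.
  have : ga_row h R * (n * n) = 0 by rewrite nn mulr0.
  rewrite ec linM mulr_sumr (bigD1 h) //= -scalerAr rowM eqxx scale1r.
  rewrite big1 ?addr0 => [|x /negPf nx]; last first.
    by rewrite -scalerAr rowM eq_sym nx scale0r scaler0.
  by move/eqP; rewrite -scalerA scaler_eq0 => /orP[/eqP ->|/eqP //]; rewrite scale0r.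
have n0 : n = 0 by rewrite ec /lin big1.
have := congr1 (fun a : grpAlg k G => a 1%g) n0; rewrite /n ga_sumE ffunE.
rewrite (bigD1 1%g) ?(group1 rsupp_group) //= ga_deltaE eqxx big1.
  by move/eqP; rewrite addr0 oner_eq0.
by move=> y /andP[_ ny]; rewrite ga_deltaE eq_sym (negPf ny).
Qed.

End Support.

(** * Evaluation at multiplicative functions *)

Section Evaluation.
Local Open Scope ring_scope.
Variables (k : fieldType) (H : finGroupType).
Local Notation δ := (@ga_delta k _).
Implicit Types (A : {group H}) (a b : grpAlg k H) (l : H -> k).

Definition supported (B : {set H}) a := forall x, x \notin B -> a x = 0.

Definition mult_on (B : {set H}) l :=
  l 1%g = 1 /\ {in B &, forall x y, l (x * y)%g = l x * l y}.

Definition ga_ev l a : k := \sum_x l x * a x.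

Lemma ga_ev_linear l : linear_for *%R (ga_ev l : grpAlg k H -> k).
Proof.
move=> c a b; rewrite /ga_ev mulr_sumr -big_split; apply: eq_bigr => x _ /=.
by rewrite ga_addE ga_scaleE mulrDr mulrCA.
Qed.
HB.instance Definition _ l :=
  GRing.isLinear.Build k (grpAlg k H) k _ (ga_ev l) (ga_ev_linear l).

Lemma supported1 A : supported A 1.
Proof. by move=> x nx; rewrite ga_deltaE; case: eqP nx => // ->; rewrite group1. Qed.

Lemma supportedB B a b : supported B a -> supported B b -> supported B (a - b).
Proof. by move=> sa sb x nx; rewrite !ffunE [a x]sa // [b x]sb // subrr. Qed.

Lemma supportedM A a b : supported A a -> supported A b -> supported A (a * b).
Proof.
move=> sa sb x nx; rewrite ga_mulE big1 // => y _.
have [yA|/sa ->] := boolP (y \in A); last by rewrite mul0r.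
by rewrite sb ?mulr0 // groupMl ?groupV.
Qed.

Lemma ga_ev_delta l g : ga_ev l (δ g) = l g.
Proof.
rewrite /ga_ev (bigD1 g) //= ga_deltaE eqxx mulr1 big1 ?addr0 // => x /negPf nx.
by rewrite ga_deltaE nx mulr0.
Qed.

Lemma ga_ev1 l : ga_ev l 1 = l 1%g. Proof. exact: ga_ev_delta. Qed.

Lemma ga_evM A l a b : mult_on A l -> supported A a -> supported A b ->
  ga_ev l (a * b) = ga_ev l a * ga_ev l b.
Proof.
move=> [_ lM] sa sb; rewrite /ga_ev mulr_suml.
under eq_bigr do rewrite ga_mulE mulr_sumr.
rewrite exchange_big; apply: eq_bigr => y _ /=.
rewrite (reindex_inj (mulgI y)) mulr_sumr; apply: eq_bigr => x _ /=.
rewrite mulKg; have [yA|/sa ->] := boolP (y \in A); last by rewrite !(mul0r, mulr0).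
have [xA|/sb ->] := boolP (x \in A); last by rewrite !mulr0.
by rewrite lM // mulrACA.
Qed.

Lemma eq_ga_ev B l l' a : supported B a -> {in B, l =1 l'} -> ga_ev l a = ga_ev l' a.
Proof.
move=> sa e; apply: eq_bigr => x _.
by have [/e ->|/sa ->] := boolP (x \in B); rewrite ?mulr0.
Qed.

End Evaluation.

Section EvaluationMap.
Local Open Scope ring_scope.
Variables (k : fieldType) (K H : finGroupType).

Lemma ga_ev_map (f : K -> H) l (a : grpAlg k K) :
  ga_ev l (ga_map f a) = \sum_x l (f x) * a x.
Proof.
rewrite ga_map_sum linear_sum; apply: eq_bigr => x _ /=.
by rewrite linearZ /= ga_ev_delta mulrC.
Qed.

Lemma supported_map (f : K -> H) (B : {set K}) (C : {set H})
    (a : grpAlg k K) :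
  supported B a -> {in B, forall x, f x \in C} -> supported C (ga_map f a).
Proof.
move=> sa fB x nx; rewrite ffunE big1 // => y /eqP fy; apply: sa.
by apply: contra nx => /fB; rewrite fy.
Qed.

End EvaluationMap.

Section Separation.
Local Open Scope ring_scope.
Variables (k : closedFieldType) (H : finGroupType) (A : {group H}).
Local Notation δ := (@ga_delta k _).
Hypotheses (cA : abelian A) (nA : #|A|%:R != 0 :> k).

(** Otherwise translation by A has a common eigenvector v in the ideal of k[A]
    generated by [a].  Its eigenvalues form a character m, and v is a multiple of
    the sum of the m(x^-1) x, at which m takes the value |A|; yet m vanishes on
    the ideal. *)
Lemma characters_separate (a : grpAlg k H) : supported A a ->
  (forall l, mult_on A l -> ga_ev l a = 0) -> a = 0.
Proof.
move=> sa ea; apply/eqP; apply: contraT => na.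
pose V : {vspace grpAlg k H} := (\sum_(h in A) <[δ h * a]>)%VS.
have VP v : v \in V -> exists2 x, supported A x & v = x * a.
  case/memv_sumP=> vs vsP ->.
  have h i : exists c : k, i \in A -> vs i = c *: (δ i * a).
    have [iA|] := boolP (i \in A); last by exists 0.
    by have /vlineP[c ->] := vsP i iA; exists c.
  have [c hc] := choice h; exists (\sum_(i in A) c i *: δ i).
    move=> x nx; rewrite ga_sumE big1 // => i iA; rewrite ga_scaleE ga_deltaE.
    by case: eqP nx => [->|]; rewrite ?iA ?mulr0.
  by rewrite mulr_suml; apply: eq_bigr => i iA; rewrite hc // scalerAl.
have nV : V != 0%VS.
  apply: contra_neq na => V0; apply/eqP; rewrite -memv0 -V0 -[a]mul1r.
  rewrite memvE (subv_trans _ (sumv_sup 1%g _ (subvv _))) //; exact: memv_line.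
have [|g h v|v vV [nv [l hl]]] :=
    finite_common_eigenvector (T := fun g : [subg A] => amull (δ (sgval g))) nV.
- move=> g; apply/subvP=> _ /memv_imgP[v vV ->]; case/memv_sumP: vV => vs vsP ->.
  rewrite lfunE /= mulr_sumr memv_suml // => i iA; have /vlineP[c ->] := vsP i iA.
  rewrite -scalerAr memvZ // mulrA -ga_deltaM memvE.
  by rewrite (subv_trans _ (sumv_sup (sgval g * i)%g _ (subvv _))) // groupM ?subgP.
- rewrite !lfunE /= !mulrA -!ga_deltaM.
  by rewrite (centsP cA) ?subgP.
have {}hl x : x \in A -> δ x * v = l (subg A x) *: v.
  by move=> xA; rewrite -hl lfunE /= subgK.
have [x sx ev] := VP v vV.
have sv : supported A v by rewrite ev; apply: supportedM.
have vE y : y \in A -> v y = l (subg A y^-1) * v 1%g.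
  by move=> yA; rewrite -ga_scaleE -hl ?groupV // ga_delta_mulE invgK mulg1.
have nv1 : v 1%g != 0.
  apply: contra_neq nv => v1; apply/ffunP=> y; rewrite [RHS]ffunE.
  by have [yA|/sv //] := boolP (y \in A); rewrite vE // v1 mulr0.
pose m y := l (subg A y).
have mM : mult_on A m.
  have Z c d : c *: v = d *: v -> c = d.
    by move/eqP; rewrite -subr_eq0 -scalerBl scaler_eq0 (negPf nv) orbF subr_eq0 => /eqP.
  split=> [|y z yA zA]; apply: Z; first by rewrite -hl // mul1r scale1r.
  by rewrite -hl ?groupM // ga_deltaM -mulrA hl // -scalerAr hl // scalerA mulrC.
have : ga_ev m v = 0 by rewrite ev (ga_evM mM) // ea // mulr0.
suff -> : ga_ev m v = #|A|%:R * v 1%g by move/eqP; rewrite mulf_eq0 (negPf nA) (negPf nv1).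
rewrite /ga_ev (bigID (mem A)) /= [X in _ + X]big1 ?addr0 => [|y /sv ->]; last by rewrite mulr0.
rewrite -sum1_card natr_sum mulr_suml; apply: eq_bigr => y yA.
have [m1 mMM] := mM.
by rewrite vE // mulrA -[l (subg A y^-1)]/(m y^-1)%g -mMM ?groupV // mulgV m1.
Qed.

Lemma characters_separate_eq (a b : grpAlg k H) : supported A a -> supported A b ->
  (forall l, mult_on A l -> ga_ev l a = ga_ev l b) -> a = b.
Proof.
move=> sa sb e; apply/eqP; rewrite -subr_eq0; apply/eqP; apply: characters_separate.
  exact: supportedB.
by move=> l hl; rewrite linearB /= e // subrr.
Qed.

End Separation.

(** * Characters of an abelian subgroup *)

Section CharacterValues.
Local Open Scope ring_scope.
Variables (k : fieldType) (G : finGroupType) (A : {group G}).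
Implicit Types chi psi : charGrp k A.

(** [subg A] maps the elements outside A to 1, so that this extends [chi] by 1
    to all of G. *)
Definition char_val chi (x : G) : k := units_val (val chi (subg A x)).

Lemma char_val_mult chi : mult_on A (char_val chi).
Proof.
have /charGrp_predP chiM := valP chi.
have subgM x y : x \in A -> y \in A -> subg A (x * y) = (subg A x * subg A y)%g.
  by move=> xA yA; apply: val_inj; rewrite /= !subgK ?groupM.
split=> [|x y xA yA]; last by rewrite /char_val subgM // chiM.
have e : subg A 1 = 1%g by apply: val_inj; rewrite /= subgK.
rewrite /char_val e; suff -> : val chi 1%g = 1%g by [].
by apply: (mulgI (val chi 1%g)); rewrite -chiM !mulg1.
Qed.

Lemma char_val1 chi : char_val chi 1%g = 1.
Proof. by case: (char_val_mult chi). Qed.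

Lemma char_valM chi :
  {in A &, forall x y, char_val chi (x * y)%g = char_val chi x * char_val chi y}.
Proof. by case: (char_val_mult chi). Qed.

Lemma char_mulE chi psi x : char_val (chi * psi)%g x = char_val chi x * char_val psi x.
Proof. by rewrite /char_val [val (chi * psi)%g]/(mulg _ _) /= ffunE. Qed.

Lemma char_oneE x : char_val 1%g x = 1.
Proof. by rewrite /char_val /= ffunE. Qed.

Lemma char_val_inj chi psi : {in A, char_val chi =1 char_val psi} -> chi = psi.
Proof.
move=> e; apply/val_inj/ffunP=> x; apply/val_inj.
by have := e _ (subgP x); rewrite /char_val sgvalK.
Qed.

(** A multiplicative function does not vanish on A, hence takes its values in
    the units of k. *)
Lemma exists_char (l : G -> k) : mult_on A l ->
  exists chi, {in A, forall x, char_val chi x = l x}.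
Proof.
move=> [l1 lM].
have lu (x : [subg A]) : l (sgval x) \is a GRing.unit.
  apply/unitrP; exists (l (sgval x)^-1%g).
  by rewrite -!lM ?groupV ?subgP // mulVg mulgV.
pose f : {ffun [subg A] -> units k} := [ffun x => Units (lu x)].
have fP : charGrp_pred f.
  by apply/charGrp_predP=> x y; rewrite !ffunE; apply/val_inj; rewrite /= lM ?subgP.
by exists (Sub f fP) => x xA; rewrite /char_val SubK ffunE /= subgK.
Qed.

Lemma char_conjE (nA : (A <| [set: G])%g) g chi : {in A, forall x,
  char_val (charGrp_conj nA g chi) x = char_val chi (x ^ g)%g}.
Proof. by move=> x xA; rewrite /char_val /charGrp_conj SubK ffunE /= subgK. Qed.

Definition pair_ev chi psi (t : grpAlg k (G * G)%type) : k :=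
  ga_ev (fun z => char_val chi z.1 * char_val psi z.2) t.

Lemma pair_mult chi psi :
  mult_on (finset.setX A A) (fun z => char_val chi z.1 * char_val psi z.2).
Proof.
split=> [|[a b] [c d] /setXP[aA bA] /setXP[cA dA]] /=; first by rewrite !char_val1 mulr1.
by rewrite !char_valM // mulrACA.
Qed.

Lemma mult_pair (l : G * G -> k) : mult_on (finset.setX A A) l ->
  exists chi psi, {in finset.setX A A, forall z, l z = char_val chi z.1 * char_val psi z.2}.
Proof.
move=> [l1 lM].
have [|chi hchi] := @exists_char (fun x => l (x, 1%g)).
  split=> // x y xA yA; rewrite -lM ?mulg_pair ?mulg1 //; first by rewrite inE /= xA group1.
  by rewrite inE /= yA group1.
have [|psi hpsi] := @exists_char (fun x => l (1%g, x)).
  split=> // x y xA yA; rewrite -lM ?mulg_pair ?mulg1 //; first by rewrite inE /= xA group1.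
  by rewrite inE /= yA group1.
exists chi, psi => -[x y] /setXP[xA yA] /=; rewrite hchi // hpsi // -lM.
- by rewrite mulg_pair mulg1 mul1g.
- by rewrite inE /= xA group1.
- by rewrite inE /= yA group1.
Qed.

End CharacterValues.

Section Separate.
Local Open Scope ring_scope.
Variables (k : closedFieldType) (G : finGroupType) (A : {group G}).
Hypotheses (cA : abelian A) (nA : #|A|%:R != 0 :> k).

Lemma setX_abelian (K : finGroupType) (B : {group K}) : abelian B ->
  abelian (finset.setX A B).
Proof.
move=> cB; apply/centsP=> -[a b] /setXP[aA bA] [c d] /setXP[cA' dA].
by rewrite /commute !mulg_pair (centsP cA) // (centsP cB).
Qed.

Lemma setX_card_neq0 (K : finGroupType) (B : {group K}) : #|B|%:R != 0 :> k ->
  #|finset.setX A B|%:R != 0 :> k.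
Proof. by move=> nB; rewrite cardsX natrM mulf_neq0. Qed.

Lemma pair_ev_inj (s t : grpAlg k (G * G)%type) :
  supported (finset.setX A A) s -> supported (finset.setX A A) t ->
  (forall chi psi : charGrp k A, pair_ev chi psi s = pair_ev chi psi t) -> s = t.
Proof.
move=> ss st e.
apply: (characters_separate_eq (A := setX_group A A)) => //.
- exact: setX_abelian.
- exact: setX_card_neq0.
move=> l /mult_pair[chi [psi lE]].
by rewrite (eq_ga_ev ss lE) (eq_ga_ev st lE) -/(pair_ev _ _ _) e.
Qed.

Lemma char_ev_inj (s t : grpAlg k G) : supported A s -> supported A t ->
  (forall chi : charGrp k A, ga_ev (char_val chi) s = ga_ev (char_val chi) t) -> s = t.
Proof.
move=> ss st e; apply: (characters_separate_eq cA) => // l /exists_char[chi hchi].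
by rewrite -(eq_ga_ev ss hchi) -(eq_ga_ev st hchi).
Qed.

(** If a is in A but not in L, the element n (1 - a), where n is the sum of the
    elements of L, is nonzero.  But every character of A kills it: a nontrivial
    one on L kills n, and otherwise the character is trivial. *)
Lemma characters_detect_subgroup (L : {group G}) : (L \subset A) ->
  (forall chi : charGrp k A, {in L, forall x, char_val chi x = 1} -> chi = 1%g) ->
  L = A.
Proof.
move=> LA h; apply/val_inj/eqP; rewrite finset.eqEsubset LA; apply/fintype.subsetP=> a aA.
apply: contraT => naL; have := oner_neq0 k.
pose n : grpAlg k G := \sum_(x in L) ga_delta k x.
have sn : supported A n.
  move=> x nx; rewrite ga_sumE big1 // => y yL; rewrite ga_deltaE.
  by case: eqP nx => // ->; rewrite (fintype.subsetP LA).
have sa : supported A (ga_delta k a).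
  by move=> x nx; rewrite ga_deltaE; case: eqP nx => // ->; rewrite aA.
suff : n = n * ga_delta k a.
  have nE x : n x = (x \in L)%:R.
    rewrite ga_sumE; case xL: (x \in L).
      rewrite (bigD1 x) //= ga_deltaE eqxx big1 ?addr0 // => y /andP[_ /negPf ny].
      by rewrite ga_deltaE eq_sym ny.
    by rewrite big1 // => y yL; rewrite ga_deltaE; case: eqP xL => // ->; rewrite yL.
  move/(congr1 (fun t : grpAlg k G => t 1%g)); rewrite ga_mul_deltaE !nE group1 mul1g.
  by rewrite groupV (negPf naL) => /eqP ->.
apply: char_ev_inj => //; first exact: supportedM.
move=> chi; rewrite (ga_evM (char_val_mult chi)) // ga_ev_delta.
have [/forallP c1|] := boolP [forall x, (x \in L) ==> (char_val chi x == 1)].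
  rewrite (h chi) ?char_oneE ?mulr1 // => x xL; apply/eqP.
  exact: (implyP (c1 x)).
rewrite negb_forall => /existsP[x]; rewrite negb_imply => /andP[xL nx].
suff -> : ga_ev (char_val chi) n = 0 by rewrite mul0r.
apply/eqP; have : ga_ev (char_val chi) n = char_val chi x * ga_ev (char_val chi) n.
  rewrite -[in RHS](ga_ev_delta (char_val chi) x) -(ga_evM (char_val_mult chi)) //.
    congr (ga_ev _ _); rewrite mulr_sumr [LHS](reindex_inj (mulgI x)).
    by apply: eq_big => [y|y _]; rewrite ?groupMl // ga_deltaM.
  move=> y ny; rewrite ga_deltaE; case: eqP ny => // ->.
  by rewrite (fintype.subsetP LA).
move/eqP; rewrite -subr_eq0 -{1}[ga_ev _ _]mul1r -mulrBl mulf_eq0 subr_eq0 eq_sym.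
by rewrite (negPf nx).
Qed.

End Separate.

(** * The form attached to an invariant twist *)

Section RForm.
Local Open Scope ring_scope.
Variables (k : closedFieldType) (G : finGroupType) (F : grpAlg k (G * G)%type).
Local Notation δ := (@ga_delta k _).
Hypotheses (uF : F \is a GRing.unit) (iF : comul_invariant F) (tF : twist_condition F).
Let R := rmatrix F.
Let rowM := rmatrix_rowM uF iF tF.
Let colM := rmatrix_colM uF iF tF.
Let row_sum := rmatrix_row_sum uF iF tF.
Let flip := rmatrix_flip uF iF tF.
Let conj := rmatrix_conj uF iF.

Definition rform_group : {group G} := rsupp_group rowM colM row_sum.
Local Notation A := rform_group.

Lemma rform_abelian : abelian A.
Proof. exact: rsupp_abelian rowM colM. Qed.

Lemma rform_normal : (A <| [set: G])%g.
Proof. exact: rsupp_normal conj. Qed.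

Lemma rform_card : #|A|%:R != 0 :> k.
Proof. exact: rsupp_card rowM colM row_sum. Qed.

Lemma rmatrix_supported : supported (finset.setX A A) R.
Proof.
move=> [x y]; apply: contraNeq => nR; rewrite inE /=.
by rewrite (rsupp_right nR) (rsupp_left flip nR).
Qed.

Lemma supported_row x : supported A (ga_row x R).
Proof. by move=> y nA; rewrite ga_rowE rmatrix_supported // inE /= (negPf nA) andbF. Qed.

Lemma supported_col y : supported A (ga_col y R).
Proof. by move=> x nA; rewrite ga_colE rmatrix_supported // inE /= (negPf nA). Qed.

Implicit Types chi psi : charGrp k A.

Lemma pair_ev_rows chi psi :
  pair_ev chi psi R = \sum_x char_val chi x * ga_ev (char_val psi) (ga_row x R).
Proof.
rewrite /pair_ev /ga_ev sum_pair; apply: eq_bigr => x _; rewrite mulr_sumr.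
by apply: eq_bigr => y _; rewrite ga_rowE mulrA.
Qed.

Lemma pair_ev_cols chi psi :
  pair_ev chi psi R = \sum_y char_val psi y * ga_ev (char_val chi) (ga_col y R).
Proof.
rewrite /pair_ev /ga_ev sum_pair exchange_big; apply: eq_bigr => x _; rewrite mulr_sumr.
by apply: eq_bigr => y _; rewrite ga_colE /= mulrCA mulrA.
Qed.

Let sum_idem (f g h : G -> k) :
  (forall x y, h x * h y = (x == y)%:R * h x) ->
  \sum_x (f x * g x) * h x = (\sum_x f x * h x) * (\sum_x g x * h x).
Proof.
move=> hh; rewrite mulr_suml; apply: eq_bigr => x _; rewrite mulr_sumr (bigD1 x) //=.
rewrite mulrACA hh eqxx mul1r big1 ?addr0 // => y /negPf ny.
by rewrite mulrACA hh eq_sym ny mul0r mulr0.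
Qed.

(** [chi * chi'] multiplies the coefficients of a combination of the rows,
    which are orthogonal idempotents. *)
Lemma pair_evMl chi chi' psi :
  pair_ev (chi * chi')%g psi R = pair_ev chi psi R * pair_ev chi' psi R.
Proof.
rewrite !pair_ev_rows -sum_idem; first by apply: eq_bigr => x _; rewrite char_mulE.
move=> x y; rewrite -(ga_evM (char_val_mult psi)); try exact: supported_row.
by rewrite rowM linearZ.
Qed.

Lemma pair_evMr chi psi psi' :
  pair_ev chi (psi * psi')%g R = pair_ev chi psi R * pair_ev chi psi' R.
Proof.
rewrite !pair_ev_cols -sum_idem; first by apply: eq_bigr => x _; rewrite char_mulE.
move=> x y; rewrite -(ga_evM (char_val_mult chi)); try exact: supported_col.
by rewrite colM linearZ.
Qed.

Lemma pair_ev1l psi : pair_ev 1%g psi R = 1.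
Proof.
rewrite pair_ev_rows (eq_bigr (fun x => ga_ev (char_val psi) (ga_row x R))).
  by rewrite -linear_sum /= row_sum ga_ev1 char_val1.
by move=> x _; rewrite char_oneE mul1r.
Qed.

Lemma pair_ev_unit chi psi : pair_ev chi psi R \is a GRing.unit.
Proof.
apply/unitrP; exists (pair_ev chi^-1%g psi R).
by rewrite -!pair_evMl mulVg mulgV pair_ev1l.
Qed.

(** Let e be the sum of the chi(x^-1) x, so that x e = chi(x) e for x in A.
    Then R multiplies e (x) e by b(chi, chi), so e would vanish if this
    scalar were not 1. *)
Lemma pair_ev_alt chi : pair_ev chi chi R = 1.
Proof.
pose e : grpAlg k G := \sum_(x in A) char_val chi x^-1%g *: δ x.
have eE x : e x = if x \in A then char_val chi x^-1%g else 0.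
  rewrite ga_sumE; case: ifP => xA.
    rewrite (bigD1 x) //= ga_scaleE ga_deltaE eqxx mulr1 big1 ?addr0 // => y /andP[_ /negPf ny].
    by rewrite ga_scaleE ga_deltaE eq_sym ny mulr0.
  rewrite big1 // => y yA; rewrite ga_scaleE ga_deltaE.
  by case: eqP xA => [->|_ _]; rewrite ?yA ?mulr0.
have er x : x \in A -> e * δ x = char_val chi x *: e.
  move=> xA; apply/ffunP=> y; rewrite ga_mul_deltaE ga_scaleE !eE groupMr ?groupV //.
  case: ifP => yA; last by rewrite mulr0.
  by rewrite invMg invgK char_valM ?groupV.
have el x : x \in A -> δ x * e = char_val chi x *: e.
  move=> xA; apply/ffunP=> y; rewrite ga_delta_mulE ga_scaleE !eE groupMl ?groupV //.
  case: ifP => yA; last by rewrite mulr0.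
  by rewrite invMg invgK char_valM ?groupV // mulrC.
have RA z : R z != 0 -> z.1 \in A /\ z.2 \in A.
  case: z => x y nR; split; [exact: rsupp_left nR|exact: rsupp_right nR].
apply/eqP/negPn/negP=> nb.
suff e0 : e = 0.
  have := congr1 (fun a : grpAlg k G => a 1%g) e0.
  by rewrite /= eE group1 invg1 char_val1 ffunE => /eqP; rewrite oner_eq0.
apply: (no_odd_component uF tF (R := R) (c := pair_ev chi chi R)) => //.
- by rewrite rmatrixK.
- rewrite [R]ga_sum_delta mulr_sumr mulr_suml; apply: eq_bigr => -[x y] _.
  have [->|/RA[xA yA]] := eqVneq (R (x, y)) 0; first by rewrite !scale0r mulr0 mul0r.
  rewrite -scalerAl -scalerAr -ga_tens_delta -!ga_tensM mulr1 mul1r.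
  by rewrite er // el.
- rewrite {1}[R]ga_sum_delta mulr_sumr scaler_suml; apply: eq_bigr => -[x y] _ /=.
  have [->|/RA[xA yA]] := eqVneq (R (x, y)) 0; first by rewrite mulr0 !scale0r mulr0.
  rewrite -scalerAr -ga_tens_delta -ga_tensM er // er //.
  rewrite mulrC -scalerA; congr (_ *: _); apply/ffunP=> -[a b].
  by rewrite ga_scaleE !ffunE /= mulrACA.
Qed.

Definition rform chi psi : units k := Units (pair_ev_unit chi psi).

Lemma rform_bimult : bimultiplicative rform.
Proof. by split=> x y z; apply/val_inj; rewrite /= ?pair_evMl ?pair_evMr. Qed.

Lemma rform_alternating : form_alternating rform.
Proof. by move=> x; apply/val_inj; rewrite /= pair_ev_alt. Qed.

(** If b(chi, psi) = 1 for all psi, then the combination of the rows of R with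
    coefficients chi(x) is 1, like their sum.  The rows being orthogonal
    idempotents, and nonzero for x in A, this gives chi(x) = 1. *)
Lemma rform_nondegenerate : form_nondegenerate rform.
Proof.
have anti x y : (rform x y * rform y x = 1)%g.
  have [Ml Mr] := rform_bimult; have := rform_alternating (x * y)%g.
  by rewrite Ml !Mr !rform_alternating mulg1 mul1g.
have ndl chi : (forall psi, rform chi psi = 1%g) -> chi = 1%g.
  move=> h; apply: char_val_inj => x xA; rewrite char_oneE.
  have s1 : \sum_x char_val chi x *: ga_row x R = 1.
    apply: (char_ev_inj rform_abelian rform_card).
    - by move=> y yA; rewrite ga_sumE big1 // => z _; rewrite ga_scaleE supported_row ?mulr0.
    - exact: supported1.
    move=> psi; rewrite ga_ev1 char_val1 linear_sum /=.
    have /(congr1 (@units_val k)) /= := h psi; rewrite pair_ev_rows => <-.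
    by apply: eq_bigr => y _; rewrite linearZ.
  have : ga_row x R * (\sum_x char_val chi x *: ga_row x R) = ga_row x R by rewrite s1 mulr1.
  rewrite mulr_sumr (bigD1 x) //= -scalerAr rowM eqxx scale1r big1 ?addr0; last first.
    by move=> y /negPf ny; rewrite -scalerAr rowM eq_sym ny scale0r scaler0.
  have : x^-1%g \in A by rewrite groupV.
  case/rsuppP=> z; rewrite flip invgK -ga_rowE => nz.
  move/(congr1 (fun a : grpAlg k G => a z)); rewrite ga_scaleE => e.
  by apply: (mulIf nz); rewrite mul1r.
split=> // psi h; apply: ndl => chi.
by have := anti chi psi; rewrite h mul1g.
Qed.

Lemma rform_invariant : conj_invariant rform_normal rform.
Proof.
move=> g chi psi; apply/val_inj; rewrite /= /pair_ev.
rewrite (@eq_ga_ev _ _ (finset.setX A A) _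
  (fun z => char_val chi (z.1 ^ g)%g * char_val psi (z.2 ^ g)%g)).
- have jI : injective (fun z : G * G => (z.1 ^ g, z.2 ^ g)%g).
    by move=> [a b] [c d] [/conjg_inj -> /conjg_inj ->].
  rewrite /ga_ev [RHS](reindex_inj jI); apply: eq_bigr => -[x y] _ /=.
  by rewrite conj.
- exact: rmatrix_supported.
- by move=> [x y] /setXP[xA yA] /=; rewrite !char_conjE.
Qed.

End RForm.

Section Matching.
Local Open Scope ring_scope.
Variables (p : nat) (k : closedFieldType) (G : finGroupType).
Hypothesis hp : p \in [pchar k].
Implicit Types (R : grpAlg k (G * G)%type) (B : BG p k G).

Lemma coprime_pchar n : coprime n p = (n%:R != 0 :> k).
Proof. by rewrite coprime_sym prime_coprime ?(pcharf_prime hp) // (dvdn_pcharf hp). Qed.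

(** [has_form R B] says that R is the element of k[A] (x) k[A] whose Fourier
    transform is the form of [B]. *)
Definition has_form R B := supported (finset.setX (BG_grp B) (BG_grp B)) R /\
  forall chi psi : charGrp k (BG_grp B), pair_ev chi psi R = units_val (BG_form chi psi).

Lemma has_form_inj R R' B : has_form R B -> has_form R' B -> R = R'.
Proof.
move=> [sR eR] [sR' eR']; apply: (pair_ev_inj (BG_abelian B)) => //.
  by rewrite -coprime_pchar BG_coprime.
by move=> chi psi; rewrite eR eR'.
Qed.

Lemma form1l (A : {group G}) (b : charGrp k A -> charGrp k A -> units k) y :
  bimultiplicative b -> b 1%g y = 1%g.
Proof. by case=> Ml _; apply: (mulgI (b 1%g y)); rewrite -Ml !mulg1. Qed.

(** A character of A that is trivial on the elements occurring in R lies
    in the radical of the form, hence is trivial.  So these elements generate A,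
    and R determines A. *)
Lemma has_form_group R B : has_form R B ->
  BG_grp B = <<[set x | [exists y, R (x, y) != 0]]>>%G.
Proof.
move=> [sR eR]; apply/esym.
have LP x y : R (x, y) != 0 -> x \in <<[set x | [exists y, R (x, y) != 0]]>>%g.
  by move=> nR; apply/mem_gen; rewrite inE; apply/existsP; exists y.
apply: (@characters_detect_subgroup k G (BG_grp B) (BG_abelian B)).
- by rewrite -coprime_pchar BG_coprime.
- rewrite gen_subG; apply/fintype.subsetP=> x; rewrite inE => /existsP[y].
  by apply: contraR => nx; rewrite sR // inE /= (negPf nx).
move=> chi h; have [nd _] := BG_nondegenerate B; apply: nd => psi.
apply/val_inj; rewrite /= -eR -[RHS](congr1 (@units_val k) (form1l psi (BG_bilinear B))) -eR.
apply: eq_bigr => -[x y] _ /=.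
have [->|/LP xL] := eqVneq (R (x, y)) 0; first by rewrite !mulr0.
by rewrite h // char_oneE.
Qed.

Lemma has_form_unique R B B' : has_form R B -> has_form R B' -> B = B'.
Proof.
move=> hB hB'; have := etrans (has_form_group hB) (esym (has_form_group hB')).
case: hB hB' => _; case: B => A b cA nA pA bA aA ndA iA /= e [_].
case: B' => A' b' cA' nA' pA' bA' aA' ndA' iA' /= e' eA.
(* transport along the equality of groups before comparing the forms *)
case: _ / eA b' e' cA' nA' pA' bA' aA' ndA' iA' => b' e' cA' nA' pA' bA' aA' ndA' iA'.
have eb : b = b'.
  by apply/funext=> x; apply/funext=> y; apply/val_inj; rewrite /= -e -e'.
case: _ / eb {e e'} bA' aA' ndA' iA' => bA' aA' ndA' iA'.
have -> : cA = cA' by apply: bool_irrelevance.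
move: iA; have -> : nA = nA' by apply: bool_irrelevance.
move=> iA; have -> : pA = pA' by apply: bool_irrelevance.
by congr Build_BG; apply: Prop_irrelevance.
Qed.

Lemma has_form_rmatrix F : F \is a GRing.unit -> comul_invariant F ->
  twist_condition F -> exists B, has_form (rmatrix F) B.
Proof.
move=> uF iF tF.
have cop : coprime #|rform_group uF iF tF| p by rewrite coprime_pchar rform_card.
exists (@Build_BG p k G _ _ (rform_abelian uF iF tF) _ cop
  (@rform_bimult _ _ _ uF iF tF) (@rform_alternating _ _ _ uF iF tF)
  (@rform_nondegenerate _ _ _ uF iF tF) (@rform_invariant _ _ _ uF iF tF)).
by split=> //; apply: rmatrix_supported.
Qed.

Lemma has_form1 : has_form 1 (BG_one p k G).
Proof.
split=> [|chi psi]; first exact: (@supported1 k _ (setX_group (1%G : {group G}) (1%G : {group G}))).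
by rewrite /pair_ev ga_ev1 /= !char_val1 mulr1.
Qed.

End Matching.

(** * Twists from bicharacters *)

Section Fourier.
Local Open Scope ring_scope.
Variables (k : closedFieldType) (G : finGroupType) (A : {group G}).
Local Notation δ := (@ga_delta k _).
Hypothesis (nA : #|A|%:R != 0 :> k).
Implicit Types chi psi : charGrp k A.

Lemma char_valX chi n : {in A, forall x, char_val chi (x ^+ n)%g = char_val chi x ^+ n}.
Proof.
move=> x xA; elim: n => [|n IH]; first by rewrite expg0 char_val1.
by rewrite expgS char_valM ?groupX // IH exprS.
Qed.

Lemma char_expE chi n x : char_val (chi ^+ n)%g x = char_val chi x ^+ n.
Proof.
elim: n => [|n IH]; first by rewrite expg0 char_oneE.
by rewrite expgS char_mulE IH exprS.
Qed.

Lemma char_exp_card chi : (chi ^+ #|A|)%g = 1%g.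
Proof.
apply: char_val_inj => x xA; rewrite char_expE -char_valX //.
by rewrite expg_cardG // char_val1 char_oneE.
Qed.

(** The values of a character are roots of X^|A| - 1, so a character amounts to
    a function from A to a finite set. *)
Lemma charGrp_finite : exists E : seq (charGrp k A), uniq E /\ forall chi, chi \in E.
Proof.
have n0 : (0 < #|A|)%N by rewrite cardG_gt0.
have [r hr] := closed_field_poly_normal ('X^#|A| - 1 : {poly k}).
have rP (z : k) : z ^+ #|A| = 1 -> z \in r.
  move=> z1; rewrite -root_prod_XsubC.
  have : root ('X^#|A| - 1) z by rewrite rootE !hornerE z1 subrr.
  by rewrite hr (monicP (monicXnsubC 1 n0)) scale1r.
have cr chi (x : [subg A]) : char_val chi (sgval x) \in r.
  by rewrite rP // -char_valX ?subgP // expg_cardG ?subgP // char_val1.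
pose phi chi : {ffun [subg A] -> seq_sub r} := [ffun x => SeqSub (cr chi x)].
have phiI : injective phi.
  move=> chi psi /ffunP e; apply: char_val_inj => x xA.
  by have := e (subg A x); rewrite !ffunE => -[]; rewrite subgK.
have [h hP] : exists h : {ffun [subg A] -> seq_sub r} -> charGrp k A,
    forall chi, h (phi chi) = chi.
  have ex f : exists chi, (exists psi, phi psi = f) -> phi chi = f.
    by have [[psi e]|nex] := pselect (exists psi, phi psi = f); [exists psi|exists 1%g].
  have [h hP] := choice ex; exists h => chi; apply: phiI; apply: hP; by exists chi.
exists (undup [seq h f | f <- enum {: {ffun [subg A] -> seq_sub r}}]); split.
  exact: undup_uniq.
by move=> chi; rewrite mem_undup -[chi]hP map_f // mem_enum.
Qed.

Let dual chi : grpAlg k G := [ffun x => if x \in A then char_val chi x^-1%g else 0].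

Let dual_supp chi : supported A (dual chi).
Proof. by move=> x /negPf nx; rewrite ffunE nx. Qed.

Let ev_dual chi psi : ga_ev (char_val chi) (dual psi) = (chi == psi)%:R * #|A|%:R.
Proof.
have eS : ga_ev (char_val chi) (dual psi) = \sum_(x in A) char_val chi x * char_val psi x^-1%g.
  rewrite /ga_ev [RHS]big_mkcond; apply: eq_bigr => x _; rewrite ffunE.
  by case: ifP; rewrite ?mulr0.
have [e|ne] := eqVneq chi psi.
  rewrite eS mul1r -sum1_card natr_sum; apply: eq_bigr => x xA.
  by rewrite e -char_valM ?groupV // mulgV char_val1.
have [x xA nx] : exists2 x, x \in A & char_val chi x != char_val psi x.
  apply/exists_inP; apply: contraR ne; rewrite negb_exists_in => /forall_inP h.
  by apply/eqP/char_val_inj => x xA; apply/eqP; have := h x xA; rewrite negbK.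
rewrite mul0r; apply/eqP; set s := ga_ev _ _ in eS *.
have : char_val chi x * s = char_val psi x * s.
  rewrite eS [in RHS](reindex_inj (mulgI x)) !mulr_sumr.
  apply: eq_big => [y|y yA]; first by rewrite groupMl.
  rewrite invMg !char_valM ?groupV // [in RHS]mulrC -!mulrA; congr (_ * (_ * _)).
  by rewrite -char_valM ?groupV // mulVg char_val1 mulr1.
by move/eqP; rewrite -subr_eq0 -mulrBl mulf_eq0 subr_eq0 (negPf nx).
Qed.

(** The elements sum_x chi(x^-1) x are the primitive idempotents of k[A] up to the
    factor |A|, by the orthogonality relations. *)
Lemma fourier_inversion (c : charGrp k A -> charGrp k A -> k) :
  exists2 F, supported (finset.setX A A) F & forall chi psi, pair_ev chi psi F = c chi psi.
Proof.
have [E [uE EP]] := charGrp_finite.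
exists (\sum_(chi <- E) \sum_(psi <- E)
  (c chi psi / #|A|%:R / #|A|%:R) *: ga_tens (dual chi) (dual psi)).
  move=> [x y]; rewrite inE /= negb_and => nxy; rewrite ga_sumE big1 // => chi _.
  rewrite ga_sumE big1 // => psi _; rewrite ga_scaleE ffunE /=.
  by case/orP: nxy => /dual_supp ->; rewrite ?(mul0r, mulr0).
have pt chi psi a b : pair_ev chi psi (ga_tens a b)
    = ga_ev (char_val chi) a * ga_ev (char_val psi) b.
  rewrite /pair_ev /ga_ev sum_pair mulr_suml; apply: eq_bigr => x _ /=.
  by rewrite mulr_sumr; apply: eq_bigr => y _; rewrite ffunE /= mulrACA.
move=> chi psi; rewrite /pair_ev linear_sum /= (bigD1_seq chi) //=.
rewrite [X in _ + X]big1 => [|chi' nchi]; last first.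
  rewrite linear_sum big1 // => psi' _; rewrite linearZ /= -/(pair_ev _ _ _) pt.
  by rewrite ev_dual eq_sym (negPf nchi) !(mul0r, mulr0).
rewrite addr0 linear_sum (bigD1_seq psi) //=.
rewrite [X in _ + X]big1 => [|psi' npsi]; last first.
  rewrite linearZ /= -/(pair_ev _ _ _) pt.
  by rewrite ev_dual ev_dual eq_sym (negPf npsi) !(mul0r, mulr0).
rewrite addr0 linearZ /= -/(pair_ev _ _ _) pt !ev_dual !eqxx !mul1r mulrA.
by rewrite mulfVK // mulfVK.
Qed.

End Fourier.

Section BicharacterTwist.
Local Open Scope ring_scope.
Variables (k : closedFieldType) (G : finGroupType) (A : {group G}).
Local Notation δ := (@ga_delta k _).
Hypotheses (cA : abelian A) (nA : #|A|%:R != 0 :> k) (normA : (A <| [set: G])%g).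
Implicit Types chi psi : charGrp k A.
Variable c : charGrp k A -> charGrp k A -> k.
Hypothesis c0 : forall chi psi, c chi psi != 0.
Hypothesis cMl : forall chi chi' psi, c (chi * chi')%g psi = c chi psi * c chi' psi.
Hypothesis cMr : forall chi psi psi', c chi (psi * psi')%g = c chi psi * c chi psi'.
Hypothesis cJ : forall g chi psi,
  c (charGrp_conj normA g chi) (charGrp_conj normA g psi) = c chi psi.

Let AA : {group G * G} := setX_group A A.

Let pair_evM chi psi s t : supported AA s -> supported AA t ->
  pair_ev chi psi (s * t) = pair_ev chi psi s * pair_ev chi psi t.
Proof. exact: ga_evM (pair_mult _ _). Qed.

Variable F : grpAlg k (G * G)%type.
Hypotheses (sF : supported AA F) (eF : forall chi psi, pair_ev chi psi F = c chi psi).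

Let inverse_exists : exists2 F', supported AA F' &
  (forall chi psi, pair_ev chi psi F' = (c chi psi)^-1) /\ F * F' = 1.
Proof.
have [F' sF' eF'] := fourier_inversion nA (fun chi psi => (c chi psi)^-1).
exists F' => //; split=> //.
apply: (pair_ev_inj cA nA); [exact: (supportedM sF sF')|exact: (@supported1 _ _ AA)|].
by move=> chi psi; rewrite pair_evM // eF eF' divff // /pair_ev ga_ev1 !char_val1 mulr1.
Qed.

Lemma bichar_unit : F \is a GRing.unit.
Proof. by have [F' _ [_]] := inverse_exists; apply: ga_right_inverse_unit. Qed.

Lemma bichar_rmatrix chi psi : pair_ev chi psi (rmatrix F) = c psi chi / c chi psi.
Proof.
have [F' sF' [eF' FF']] := inverse_exists.
have e : F^-1 = F' by rewrite -[F']mul1r -(mulVr bichar_unit) -mulrA FF' mulr1.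
rewrite /rmatrix e pair_evM //; last first.
  by apply: (supported_map sF) => -[x y] /setXP[xA yA]; rewrite inE /= xA yA.
rewrite eF' -(eF psi chi) /pair_ev ga_ev_map; congr (_ / _).
by apply: eq_bigr => x _ /=; congr (_ * _); rewrite mulrC.
Qed.

Lemma bichar_rmatrix_supported : supported AA (rmatrix F).
Proof.
have [F' sF' [eF' FF']] := inverse_exists.
have e : F^-1 = F' by rewrite -[F']mul1r -(mulVr bichar_unit) -mulrA FF' mulr1.
rewrite /rmatrix e; apply: supportedM => //.
by apply: (supported_map sF) => -[x y] /setXP[xA yA]; rewrite inE /= xA yA.
Qed.

Lemma bichar_invariant : comul_invariant F.
Proof.
have FJ g x y : F (x ^ g, y ^ g)%g = F (x, y).
  have AJ z : z \in A -> (z ^ g)%g \in A.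
    by move=> zA; rewrite memJ_norm // (fintype.subsetP (normal_norm normA)) ?inE.
  pose f (z : G * G) := (z.1 ^ g, z.2 ^ g)%g.
  have fI : injective f by move=> [a b] [a' b'] [/conjg_inj -> /conjg_inj ->].
  suff e : ga_map f F = F by rewrite -[(x ^ g, y ^ g)%g]/(f (x, y)) -{1}e ga_map_injE.
  apply: (pair_ev_inj cA nA) => // [|chi psi].
    by apply: (supported_map sF) => -[a b] /setXP[aA bA]; rewrite inE /= !AJ.
  rewrite eF -(cJ g) -eF /pair_ev ga_ev_map -/(ga_ev (fun x => _) F).
  apply: (eq_ga_ev sF) => -[a b] /setXP[aA bA] /=.
  by rewrite !char_conjE.
move=> a; rewrite [comul a]ga_map_sum mulr_suml mulr_sumr; apply: eq_bigr => g _.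
rewrite -scalerAl -scalerAr; congr (_ *: _); apply/ffunP=> -[x y].
rewrite ga_delta_mulE ga_mul_deltaE !invg_pair !mulg_pair -(FJ g^-1%g).
by rewrite !conjgE invgK -!mulgA !mulKVg.
Qed.

(** Characters of A^3 turn the twist equation into the cocycle identity
    c(chi, psi) c(chi psi, phi) = c(psi, phi) c(chi, psi phi). *)
Lemma bichar_twist : twist_condition F.
Proof.
pose A3 : {group G * G * G} := setX_group AA A.
have [F1E F2E] : ga_tens F (1 : grpAlg k G) = ga_map (fun x : G * G => (x.1, x.2, 1%g)) F /\
    ga_assoc (ga_tens (1 : grpAlg k G) F) = ga_map (fun x : G * G => (1%g, x.1, x.2)) F.
  by split; [rewrite ga_tens_1r|rewrite ga_tens_1l].
have F3E : ga_assoc (id_comul F) = ga_map (fun x : G * G => (x.1, x.2, x.2)) F.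
  by rewrite /ga_assoc /id_comul ga_map_comp.
have smap f : {in AA, forall x, f x \in A3} -> supported A3 (ga_map f F).
  by move=> h; apply: (supported_map sF).
have s1 : supported A3 (ga_map (fun x : G * G => (x.1, x.2, 1%g)) F).
  by apply: smap => -[x y] /setXP[xA yA]; rewrite !inE /= xA yA group1.
have s2 : supported A3 (ga_map (fun x : G * G => (1%g, x.1, x.2)) F).
  by apply: smap => -[x y] /setXP[xA yA]; rewrite !inE /= xA yA group1.
have s3 : supported A3 (ga_map (fun x : G * G => (x.1, x.2, x.2)) F).
  by apply: smap => -[x y] /setXP[xA yA]; rewrite !inE /= xA yA.
have s4 : supported A3 (comul_id F).
  by apply: smap => -[x y] /setXP[xA yA]; rewrite !inE /= xA yA.
rewrite /twist_condition ga_assocM F1E F2E F3E.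
have cAA : abelian AA by exact: setX_abelian.
have nAA : #|AA|%:R != 0 :> k by exact: setX_card_neq0.
apply: (characters_separate_eq (A := A3)).
- exact: setX_abelian.
- exact: setX_card_neq0.
- exact: (supportedM s1 s4).
- exact: (supportedM s2 s3).
move=> l lm; rewrite (ga_evM lm s1 s4) (ga_evM lm s2 s3).
have [chi [psi [phi lE]]] : exists chi psi phi : charGrp k A, {in A3, forall z,
    l z = char_val chi z.1.1 * char_val psi z.1.2 * char_val phi z.2}.
  have [l1 lM] := lm.
  have [|chi [psi hcp]] := @mult_pair _ _ A (fun z => l (z, 1%g)).
    split=> // x y xA yA; rewrite -lM ?mulg_pair ?mulg1 //.
      by rewrite inE /= xA group1.
    by rewrite inE /= yA group1.
  have [|phi hphi] := @exists_char _ _ A (fun x => l (1%g, x)).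
    split=> // x y xA yA; rewrite -lM ?mulg_pair ?mulg1 //.
      by rewrite inE /= xA group1.
    by rewrite inE /= yA group1.
  exists chi, psi, phi => -[x y] /setXP[xA yA] /=; rewrite -(hcp x) // hphi // -lM.
  - by rewrite mulg_pair mulg1 mul1g.
  - by rewrite inE /= xA group1.
  - by rewrite inE /= yA group1.
have ev f : {in AA, forall x, f x \in A3} -> ga_ev l (ga_map f F) =
    ga_ev (fun z => char_val chi (f z).1.1 * char_val psi (f z).1.2 * char_val phi (f z).2) F.
  move=> h; rewrite ga_ev_map -/(ga_ev (fun z => l (f z)) F).
  by apply: (eq_ga_ev sF) => z zA; rewrite lE // h.
rewrite !ev; try by move=> -[x y] /setXP[xA yA]; rewrite !inE /= ?xA ?yA ?group1.
have e1 : ga_ev (fun z : G * G => char_val chi z.1 * char_val psi z.2 * char_val phi 1%g) F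
    = c chi psi.
  by rewrite -eF; apply: (eq_ga_ev sF) => z _; rewrite char_val1 mulr1.
have e2 : ga_ev (fun z : G * G => char_val chi z.1 * char_val psi z.1 * char_val phi z.2) F
    = c (chi * psi)%g phi.
  by rewrite -eF; apply: (eq_ga_ev sF) => z _; rewrite char_mulE.
have e3 : ga_ev (fun z : G * G => char_val chi 1%g * char_val psi z.1 * char_val phi z.2) F
    = c psi phi.
  by rewrite -eF; apply: (eq_ga_ev sF) => z _; rewrite char_val1 mul1r.
have e4 : ga_ev (fun z : G * G => char_val chi z.1 * char_val psi z.2 * char_val phi z.2) F
    = c chi (psi * phi)%g.
  by rewrite -eF; apply: (eq_ga_ev sF) => z _; rewrite char_mulE mulrA.
rewrite /= e1 e2 e3 e4 cMl cMr; rewrite mulrC -mulrA mulrCA; congr (_ * _).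
by rewrite mulrC.
Qed.

End BicharacterTwist.

Section OddSurjectivity.
Local Open Scope ring_scope.
Variables (p : nat) (k : closedFieldType) (G : finGroupType).
Hypothesis hp : p \in [pchar k].

(** The bicharacter c with c(chi, psi) = b(psi, chi)^m, m = (|A|+1)/2, gives a
    twist with form c(psi, chi) / c(chi, psi) = b(chi, psi)^(2m) = b(chi, psi), as
    b is antisymmetric with values of order dividing |A|. *)
Lemma odd_has_form (B : BG p k G) : odd #|BG_grp B| ->
  exists F, [/\ F \is a GRing.unit, comul_invariant F, twist_condition F &
    has_form (rmatrix F) B].
Proof.
move=> oB; have cA := BG_abelian B; have [bMl bMr] := BG_bilinear B.
have nA : #|BG_grp B|%:R != 0 :> k by rewrite -(coprime_pchar hp) BG_coprime.
set A := BG_grp B in cA bMl bMr nA oB *.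
pose b (chi psi : charGrp k A) : k := units_val (BG_form chi psi).
have kMl x y z : b (x * y)%g z = b x z * b y z by rewrite /b bMl.
have kMr x y z : b x (y * z)%g = b x y * b x z by rewrite /b bMr.
have kalt x : b x x = 1 by rewrite /b BG_alternating.
have kanti x y : b x y * b y x = 1.
  by have := kalt (x * y)%g; rewrite kMl !kMr !kalt mulr1 mul1r.
have k1 y : b 1%g y = 1 by rewrite /b form1l //; apply: BG_bilinear.
have kX x y n : b (x ^+ n)%g y = b x y ^+ n.
  by elim: n => [|n IH]; rewrite ?expg0 // expgS kMl IH exprS.
have kn x y : b x y ^+ #|A| = 1 by rewrite -kX char_exp_card.
have k0 x y : b x y != 0 by rewrite -unitfE units_prf.
pose m := uphalf #|A|.
have b2m x y : b x y ^+ m * b x y ^+ m = b x y.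
  by rewrite -exprD addnn odd_uphalfK // exprS kn mulr1.
pose c (chi psi : charGrp k A) := b psi chi ^+ m.
have [F sF eF] := fourier_inversion nA c.
have c0 x y : c x y != 0 by rewrite expf_neq0.
have cMl x y z : c (x * y)%g z = c x z * c y z by rewrite /c kMr exprMn.
have cMr x y z : c x (y * z)%g = c x y * c x z by rewrite /c kMl exprMn.
have cJ g x y : c (charGrp_conj (BG_normal B) g x) (charGrp_conj (BG_normal B) g y) = c x y.
  by rewrite /c /b BG_invariant.
exists F; split.
- exact: (bichar_unit cA nA c0 sF eF).
- exact: (bichar_invariant cA nA cJ sF eF).
- exact: (bichar_twist cA nA cMl cMr sF eF).
split; first exact: (bichar_rmatrix_supported cA nA c0 sF eF).
move=> chi psi; rewrite (bichar_rmatrix cA nA c0 sF eF) /c -[RHS](b2m chi psi).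
congr (_ * _); apply: (mulfI (expf_neq0 m (k0 psi chi))).
by rewrite divff ?expf_neq0 // -exprMn kanti expr1n.
Qed.

End OddSurjectivity.

(** * Symmetric twists and automorphisms *)

Section SymmetricTwists.
Local Open Scope ring_scope.
Variables (k : closedFieldType) (G : finGroupType).
Local Notation δ := (@ga_delta k _).
Implicit Types (a : grpAlg k G) (u v w : Z2 k G) (s t : {perm G}).

Definition twist_val w : grpAlg k (G * G)%type := units_val (sval w).

Lemma twist_val_unit w : twist_val w \is a GRing.unit.
Proof. exact: units_prf. Qed.
Lemma twist_val_invariant w : comul_invariant (twist_val w).
Proof. by have /asboolP[] := valP w. Qed.
Lemma twist_valP w : twist_condition (twist_val w).
Proof. by have /asboolP[] := valP w. Qed.
Lemma twist_valM v w : twist_val (v * w)%g = twist_val v * twist_val w.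
Proof. by []. Qed.
Lemma twist_valV w : twist_val w^-1%g = (twist_val w)^-1.
Proof. by []. Qed.

Lemma exists_Z2 F : F \is a GRing.unit -> comul_invariant F -> twist_condition F ->
  exists w, twist_val w = F.
Proof.
move=> uF iF tF; have zF : Z2_pred (Units uF) by apply/asboolP.
by exists (exist (fun x => Z2_pred x) (Units uF) zF).
Qed.

Definition symmetric w := swap (twist_val w) = twist_val w.

Lemma symmetric1 : symmetric 1%g. Proof. exact: swap1. Qed.
Lemma symmetricM v w : symmetric v -> symmetric w -> symmetric (v * w)%g.
Proof. by move=> sv sw; rewrite /symmetric twist_valM swapM sv sw. Qed.
Lemma symmetricV w : symmetric w -> symmetric w^-1%g.
Proof. by move=> sw; rewrite /symmetric twist_valV swapV ?twist_val_unit // sw. Qed.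

Lemma B2_symmetric w : w \in B2_pred (G:=G) -> symmetric w.
Proof.
case/asboolP=> a [ua _ e]; rewrite /symmetric /twist_val e.
by rewrite swapM swap_tens swap_comul.
Qed.

(** With w' = v^-1 w, the R-matrix of w is v_21 w'_21 w'^-1 v^-1. *)
Lemma rmatrix_eqP v w :
  rmatrix (twist_val v) = rmatrix (twist_val w) <-> symmetric (v^-1 * w)%g.
Proof.
have uv := twist_val_unit v; have uw := twist_val_unit w.
rewrite /symmetric twist_valM twist_valV swapM swapV // /rmatrix; split=> e.
  apply: (mulrI (swap_unit uv)); rewrite mulrA divrr ?swap_unit // mul1r mulrA.
  by rewrite e mulrVK.
apply: (mulIr uw); rewrite mulrVK // -mulrA -e mulrA divrr ?swap_unit //.
by rewrite mul1r.
Qed.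

(** On coefficients, a(g) a(h) = [g = h] a(g). *)
Lemma grouplikeP a : a != 0 -> comul a = ga_tens a a -> exists g, a = δ g.
Proof.
move=> na e; have aa g h : (g == h)%:R * a g = a g * a h.
  by rewrite -comulE e ffunE.
have [g ag] : exists g, a g != 0.
  apply/existsP; apply: contraR na; rewrite negb_exists => /forallP h.
  by apply/eqP/ffunP=> g; rewrite [RHS]ffunE; apply/eqP; have := h g; rewrite negbK.
exists g; apply/ffunP=> h; rewrite ga_deltaE; apply: (mulfI ag).
by rewrite -aa mulrC eq_sym.
Qed.

(** Conjugation by [a^-1] rather than [a] makes this compatible with products,
    since the product [s * t] of permutations applies [s] first. *)
Definition implements w s := exists a, [/\ a \is a GRing.unit,
  twist_val w * comul a = ga_tens a a & forall g, δ (s g) = a^-1 * δ g * a].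

Lemma implementsM v w s t : implements v s -> implements w t ->
  implements (v * w)%g (s * t)%g.
Proof.
move=> [a [ua va sa]] [b [ub wb tb]]; exists (a * b); split.
- by rewrite unitrMr.
- rewrite twist_valM comulM ga_tensM -va -wb mulrA -(mulrA _ (twist_val w)).
  by rewrite -twist_val_invariant !mulrA.
- by move=> g; rewrite permM tb sa invrM // !mulrA.
Qed.

Lemma implementsV w s : implements w s -> implements w^-1%g s^-1%g.
Proof.
move=> [a [ua wa sa]]; exists a^-1; split; first by rewrite unitrV.
  rewrite twist_valV ga_tensV // -wa invrM ?comul_unit ?twist_val_unit // comulV //.
  apply: (mulrI (twist_val_unit w)); rewrite mulrA divrr ?twist_val_unit // mul1r.
  apply: (mulrI (comul_unit ua)); rewrite divrr ?comul_unit //.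
  rewrite mulrA twist_val_invariant -mulrA mulrA (mulrA _ _ (_^-1)).
  by rewrite mulrK ?comul_unit // divrr ?twist_val_unit.
move=> g; rewrite invrK -[in RHS](permKV s g) sa !mulrA divrr // mul1r.
by rewrite mulrK.
Qed.

Lemma InnP s : reflect (exists g, forall x, s x = (x ^ g)%g) (s \in Inn_group G).
Proof.
apply: (iffP morphimP) => [[g _ _ ->]|[g sg]].
  by exists g => x; rewrite conj_autE ?inE.
exists g; first by rewrite (fintype.subsetP (normG _)) ?finset.in_setT.
  exact: finset.in_setT.
by apply/permP=> x; rewrite sg conj_autE ?inE.
Qed.

(** If w is also the coboundary of a central z, then z^-1 a is group-like, hence in
    G, and a conjugates as this group element does.  Conversely, if a conjugates
    as h in G, then a h^-1 is central and has the same coboundary as a. *)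
Lemma implements_B2 w s : implements w s -> (w \in B2_pred (G:=G)) = (s \in Inn_group G).
Proof.
move=> [a [ua wa sa]]; apply/asboolP/InnP => [[z [uz cz wz]]|[h sh]].
  have [h ah] : exists h, z^-1 * a = δ h.
    apply: grouplikeP.
      apply: contra_neq (oner_neq0 (grpAlg k G)) => e.
      by rewrite -(mulVr ua) -[a](mulVKr uz) e mulr0 mulr0.
    have : ga_tens z z * (comul z^-1 * comul a) = ga_tens a a.
      by rewrite mulrA -wa /twist_val wz.
    rewrite -comulM => e; apply: (mulrI (ga_tens_unit uz)).
    by rewrite e -ga_tensM mulVKr.
  exists h => g; apply: (@ga_delta_inj k G); rewrite sa.
  have -> : a = z * δ h by rewrite -ah mulVKr.
  rewrite invrM ?ga_delta_unit // ga_delta_inv -!mulrA (mulrA (δ g)) -cz.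
  by rewrite !mulrA mulrVK // -!ga_deltaM conjgE mulgA.
exists (a * δ h^-1%g).
have uz : a * δ h^-1%g \is a GRing.unit by rewrite unitrMr ?ga_delta_unit.
split=> //.
  move=> x; rewrite [x]ga_sum_delta mulr_sumr mulr_suml; apply: eq_bigr => g _.
  rewrite -scalerAl -scalerAr; congr (_ *: _).
  apply: (mulIr (ga_delta_unit k h)); rewrite -!mulrA -!ga_deltaM mulVg mulr1.
  have := sa g; rewrite sh conjgE => e.
  have -> : δ g * a = a * δ (h^-1 * (g * h))%g by rewrite e !mulrA divrr // mul1r.
  by [].
rewrite -/(twist_val w).
apply: (mulIr (comul_unit uz)); rewrite -mulrA -comulM mulVr // comul1 mulr1.
rewrite comulM mulrA wa comul_delta -ga_tens_delta.
by rewrite -ga_tensM.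
Qed.

(** If w is the coboundary of a, then Delta(a) = w^-1 (a (x) a).  As w commutes with
    g (x) g, it follows that Delta(a^-1 g a) is the conjugate of g (x) g by a (x) a,
    so that a^-1 g a is group-like. *)
Lemma symmetric_implements w : symmetric w -> exists2 s, s \in Int_group k G & implements w s.
Proof.
move=> sw; have uw := twist_val_unit w.
have [a ua wa] := symmetric_twist_coboundary uw (@twist_valP w) sw.
have [h hP] : exists h : G -> G, forall g, a^-1 * δ g * a = δ (h g).
  suff gl g : exists h, a^-1 * δ g * a = δ h by have [h hP] := choice gl; exists h.
  apply: grouplikeP.
    have : a^-1 * δ g * a \is a GRing.unit by rewrite !unitrMr ?ga_delta_unit ?unitrV.
    by case: eqP => // ->; rewrite unitr0.
  apply: (mulrI (ga_tens_unit ua)); rewrite -ga_tensM -!mulrA mulVKr //.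
  rewrite ga_tensM -wa ga_tens_delta !comulM comul_delta -mulrA.
  rewrite (mulrA (comul a)) -comulM divrr // comul1 mul1r.
  by rewrite !mulrA -comul_delta twist_val_invariant.
have hI : injective h.
  move=> x y e; apply: (@ga_delta_inj k G); apply: (mulIr ua).
  by apply: (mulrI (etrans (unitrV _) ua)); rewrite !mulrA !hP e.
have hM : {morph h : x y / (x * y)%g}.
  move=> x y; apply: (@ga_delta_inj k G).
  by rewrite ga_deltaM -!hP ga_deltaM !mulrA mulrK.
exists (perm hI); last by exists a; split=> // g; rewrite permE hP.
apply/setIdP; split.
  rewrite inE; apply/andP; split; first by apply/fintype.subsetP=> x; rewrite !inE.
  by apply/morphicP=> x y _ _; rewrite !permE hM.
apply/asboolP; exists a^-1; first by rewrite unitrV.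
by move=> g; rewrite invrK permE hP.
Qed.

Lemma ga_assoc_tens a b c : ga_assoc (ga_tens a (ga_tens b c)) = ga_tens (ga_tens a b) c.
Proof.
apply/ffunP=> -[[x y] z]; rewrite [LHS](@ga_map_canE k _ _ _ (fun x => (x.1.1, (x.1.2, x.2)))) /=.
- by rewrite !ffunE /= mulrA.
- by case=> ? [].
- by case=> -[].
Qed.

Lemma comul_id_tens a b : comul_id (ga_tens a b) = ga_tens (comul a) b.
Proof.
by apply/ffunP=> -[[x y] z]; rewrite comul_idE [RHS]ffunE /= comulE ffunE mulrA.
Qed.

Lemma id_comul_tens a b : id_comul (ga_tens a b) = ga_tens a (comul b).
Proof.
apply/ffunP=> -[x [y z]]; rewrite [id_comul _]ga_map_sum ga_sumE [RHS]ffunE /= comulE.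
rewrite (bigD1 (x, y)) //= ga_scaleE ga_deltaE !ffunE /= !xpair_eqE !eqxx /=.
rewrite [z == y]eq_sym big1 ?addr0 => [|[c d] ncd]; first by rewrite -mulrA [b y * _]mulrC.
rewrite ga_scaleE ga_deltaE !xpair_eqE /= in ncd *.
by case: (x =P c) ncd => [->|]; case: (y =P d) => [->|]; rewrite ?eqxx ?andbF ?mulr0.
Qed.

Lemma coboundary_twist a : a \is a GRing.unit ->
  twist_condition (ga_tens a a * comul a^-1).
Proof.
move=> ua; rewrite /twist_condition.
have -> : ga_tens (ga_tens a a * comul a^-1) (1 : grpAlg k G)
    = ga_tens (ga_tens a a) 1 * ga_tens (comul a^-1) 1 by rewrite -ga_tensM mulr1.
have -> : ga_tens (1 : grpAlg k G) (ga_tens a a * comul a^-1)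
    = ga_tens 1 (ga_tens a a) * ga_tens 1 (comul a^-1) by rewrite -ga_tensM mulr1.
rewrite comul_idM id_comulM comul_id_tens id_comul_tens.
rewrite -mulrA (mulrA (ga_tens (comul a^-1) 1)) -ga_tensM -comulM mulVr // comul1 mul1r.
rewrite -mulrA (mulrA (ga_tens 1 (comul a^-1))) -ga_tensM -comulM mulVr // comul1 mul1r.
rewrite !mulrA -!ga_tensM !mul1r !mulr1 ga_assocM ga_assoc_tens; congr (_ * _).
by rewrite /comul_id /ga_assoc /id_comul /comul !ga_map_comp.
Qed.

(** The coboundary of a unit is always a symmetric twist; it is invariant when the
    unit normalizes G. *)
Lemma Int_implements s : s \in Int_group k G -> exists2 w, symmetric w & implements w s.
Proof.
case/setIdP=> _ /asboolP[u uu us]; pose a := u^-1.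
have ua : a \is a GRing.unit by rewrite unitrV.
have sa g : δ (s g) = a^-1 * δ g * a by rewrite /a invrK us.
have uF : ga_tens a a * comul a^-1 \is a GRing.unit.
  by rewrite unitrMr ?ga_tens_unit // comul_unit ?unitrV.
have iF : comul_invariant (ga_tens a a * comul a^-1).
  move=> b; rewrite [comul b]ga_map_sum mulr_suml mulr_sumr; apply: eq_bigr => g _.
  rewrite -scalerAl -scalerAr; congr (_ *: _); rewrite -comul_delta.
  rewrite -[RHS]mulrA -comulM.
  have -> : a^-1 * δ g = δ (s g) * a^-1 by rewrite sa mulrK.
  rewrite comulM !mulrA; congr (_ * _); rewrite !comul_delta -!ga_tens_delta -!ga_tensM.
  by rewrite sa !mulrA divrr // mul1r.
have [w ew] := exists_Z2 uF iF (coboundary_twist ua).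
exists w; first by rewrite /symmetric ew swapM swap_tens swap_comul.
by exists a; split=> //; rewrite ew -mulrA -comulM mulVr // comul1 mulr1.
Qed.

End SymmetricTwists.

(** * The map Theta *)

Section Theta.
Local Open Scope classical_set_scope.
Variables (p : nat) (k : closedFieldType) (G : finGroupType).
Hypothesis hp : p \in [pchar k]%R.

(** The form does not depend on the chosen representative, because the elements
    of B^2 are symmetric, and twists that differ by a symmetric one have the same
    R-matrix. *)
Lemma Theta_exists : exists Theta : H2 k G -> BG p k G,
  forall w, has_form (rmatrix (twist_val w)) (Theta (H2_class w)).
Proof.
have h w : exists B : BG p k G, has_form (rmatrix (twist_val w)) B.
  apply: has_form_rmatrix => //; first exact: twist_val_unit.
    exact: twist_val_invariant.
  exact: twist_valP.
have [th thP] := choice h; exists (fun x => th (H2_repr x)) => w.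
have /H2_classP/B2_symmetric/rmatrix_eqP <- := H2_reprK (H2_class w).
exact: thP.
Qed.

Variable Theta : H2 k G -> BG p k G.
Hypothesis ThetaP : forall w, has_form (rmatrix (twist_val w)) (Theta (H2_class w)).

Lemma Theta_eqP v w : Theta (H2_class v) = Theta (H2_class w) <-> symmetric (v^-1 * w)%g.
Proof.
rewrite -rmatrix_eqP; split=> e.
  by apply: has_form_inj hp _ _ _ (ThetaP v) _; rewrite e.
by apply: has_form_unique hp _ _ _ (ThetaP v) _; rewrite e.
Qed.

Lemma Theta_oneP w : Theta (H2_class w) = BG_one p k G <-> symmetric w.
Proof.
have e1 : Theta (H2_class 1%g) = BG_one p k G.
  apply: has_form_unique hp _ _ _ (ThetaP 1%g) _.
  suff -> : rmatrix (twist_val (1%g : Z2 k G)) = 1%R by apply: has_form1.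
  by rewrite /rmatrix -[twist_val _]/(1%R) swap1 GRing.invr1 GRing.mulr1.
have := Theta_eqP 1%g w; rewrite e1 invg1 mul1g => <-.
by split.
Qed.

Let N := Theta @^-1` [set BG_one p k G].

Lemma H2_classV (w : Z2 k G) : ((H2_class w)^-1 = H2_class w^-1)%g.
Proof.
apply: (mulgI (H2_class w)); rewrite mulgV -H2_classM mulgV.
by [].
Qed.

Lemma Theta_fibre x z : Theta z = Theta x <-> N (x^-1 * z)%g.
Proof.
rewrite -(H2_reprK x) -(H2_reprK z) H2_classV -H2_classM /N /= Theta_oneP -Theta_eqP.
by split.
Qed.

Lemma Theta_left_coset x : left_coset x N = Theta @^-1` [set Theta x].
Proof.
apply/seteqP; split=> z /=.
  by case=> y Ny <-; apply/Theta_fibre; rewrite mulKg.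
by move/Theta_fibre=> Nz; exists (x^-1 * z)%g; rewrite ?mulKVg.
Qed.

Lemma kernel_subgroup : is_subgroup N.
Proof.
split.
- by apply/Theta_oneP/symmetric1.
- move=> x y; rewrite -(H2_reprK x) -(H2_reprK y) -H2_classM /N /=.
  by move=> /Theta_oneP sx /Theta_oneP sy; apply/Theta_oneP/symmetricM.
move=> x; rewrite -(H2_reprK x) H2_classV /N /=.
by move=> /Theta_oneP sx; apply/Theta_oneP/symmetricV.
Qed.

(** A class in the kernel is sent to the class of an automorphism implemented
    by its representative.  By [implements_B2], changing the representative or the
    implementing unit changes the automorphism by an inner one only, and two
    classes with the same image are equal. *)
Lemma kernel_isog : isog_fin N (Int_group k G / Inn_group G)%G.
Proof.
have [sI nI] := andP (Inn_normal_Int k G).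
have Ic s : s \in Int_group k G -> s \in ('N(Inn_group G))%g by move/(fintype.subsetP nI).
have h (w : Z2 k G) : exists s, symmetric w -> s \in Int_group k G /\ implements w s.
  have [sw|nsw] := pselect (symmetric w); last by exists 1%g.
  by have [s sI2 ws] := symmetric_implements sw; exists s.
have [sg sgP] := choice h.
pose f (x : H2 k G) : coset_of (Inn_group G) := coset (Inn_group G) (sg (H2_repr x)).
have NP x : N x -> symmetric (H2_repr x) by move=> Nx; apply/Theta_oneP; rewrite H2_reprK.
have cosetE (v w : Z2 k G) s t : s \in Int_group k G -> t \in Int_group k G ->
    implements v s -> implements w t ->
    H2_class v = H2_class w <-> coset (Inn_group G) s = coset (Inn_group G) t.
  move=> sI' tI vs wt; have Iv : (s^-1)%g \in ('N(Inn_group G))%g by rewrite groupV Ic.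
  have vw := implementsM (implementsV vs) wt.
  have e : coset (Inn_group G) (s^-1 * t)%g =
      ((coset (Inn_group G) s)^-1 * coset (Inn_group G) t)%g.
    apply: (etrans (morphM (coset_morphism (Inn_group G)) Iv (Ic t tI))).
    exact: (congr1 (fun z => z * _)%g (morphV (coset_morphism (Inn_group G)) (Ic s sI'))).
  split=> [/H2_classP|est].
    rewrite (implements_B2 vw) => /coset_id; rewrite e => /eqP.
    by rewrite -eq_mulVg1 => /eqP.
  apply/H2_classP; rewrite (implements_B2 vw).
  have e1 : coset (Inn_group G) (s^-1 * t)%g = 1%g by rewrite e est mulVg.
  exact: (coset_idr (groupM Iv (Ic t tI)) e1).
exists f; last first.
  move=> x y Nx Ny; have [xI xs] := sgP _ (NP x Nx); have [yI ys] := sgP _ (NP y Ny).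
  have Nxy : N (x * y)%g by have [_ h2 _] := kernel_subgroup; apply: h2.
  have [xyI xys] := sgP _ (NP _ Nxy).
  rewrite /f -morphM ?Ic //; apply/(cosetE _ _ _ _ xyI (groupM xI yI) xys (implementsM xs ys)).
  by rewrite H2_reprK H2_classM !H2_reprK.
split.
- by move=> x Nx /=; have [xI _] := sgP _ (NP x Nx); apply: mem_quotient.
- move=> x y /set_mem Nx /set_mem Ny; have [xI xs] := sgP _ (NP x Nx).
  have [yI ys] := sgP _ (NP y Ny).
  by move/(cosetE _ _ _ _ xI yI xs ys); rewrite !H2_reprK.
move=> c /= /morphimP[s _ sI' ->]; have [w sw ws] := Int_implements sI'.
exists (H2_class w); first by apply/Theta_oneP.
have Nw : N (H2_class w) by apply/Theta_oneP.
have [wI wsg] := sgP _ (NP _ Nw).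
by apply/(cosetE _ _ _ _ wI sI' wsg ws); rewrite H2_reprK.
Qed.

Lemma Theta_surjective_odd (B : BG p k G) : odd #|BG_grp B| -> exists x, Theta x = B.
Proof.
move=> oB; have [F [uF iF tF hF]] := odd_has_form hp oB.
have [w ew] := exists_Z2 uF iF tF; exists (H2_class w).
by apply: has_form_unique hp _ _ _ (ThetaP w) _; rewrite ew.
Qed.

End Theta.

Theorem theorem6p3 (k : closedFieldType) (p : nat) (hp : p \in [pchar k]%R)
    (G : finGroupType) :
  exists Theta : H2 k G -> BG p k G,
    let N := (Theta @^-1` [set BG_one p k G])%classic in
    [/\ is_subgroup N /\ isog_fin N (Int_group k G / Inn_group G)%G,
        forall S : set (H2 k G),
          (S !=set0 /\ exists B, S = Theta @^-1` [set B])%classic <->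
          exists x, S = left_coset x N,
        (forall B : BG p k G, odd #|BG_grp B|) ->
          forall B, exists x, Theta x = B &
        p = 2 -> forall B, exists x, Theta x = B].
Proof.
have [Theta ThetaP] := Theta_exists G hp; exists Theta; split.
- split; first exact: kernel_subgroup ThetaP.
  exact: kernel_isog ThetaP.
- move=> S; split=> [[[x Sx] [B eS]]|[x ->]].
    exists x; rewrite (Theta_left_coset hp ThetaP) eS.
    by move: Sx; rewrite eS /= => ->.
  rewrite (Theta_left_coset hp ThetaP); split; first by exists x.
  by exists (Theta x).
- by move=> oB B; apply: (Theta_surjective_odd hp ThetaP).
move=> p2 B; apply: (Theta_surjective_odd hp ThetaP).
by rewrite -coprimen2 -p2 BG_coprime.
Qed.
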